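(* Let $X$ be a complex Banach space with norm $\|\cdot\|$ and open unit ball $\mathbb{B}$, let $\mathbb{U}$ be the open unit disk in $\mathbb{C}$, and let $\beta\in\mathbb{R}$ with $|\beta|<\frac{\pi}{2}$. Let $g:\mathbb{U}\to\mathbb{C}$ be a biholomorphic function with $g(0)=1$ and $\operatorname{Re} g(z)>0$ for all $z\in\mathbb{U}$. Let $F:\mathbb{B}\to X$ be a holomorphic mapping of one-dimensional type (i.e. $F(x)=f(x)\,x$ for some holomorphic $f:\mathbb{B}\to\mathbb{C}$) such that $F(0)=0$, $DF(0)=I$, $DF(x)$ has a bounded inverse for every $x\in\mathbb{B}$, and $(DF(x))^{-1}F(x)\in\widehat{\mathcal{M}}_g(\beta)$ (the class defined in the context). Then for every $\lambda\in\mathbb{C}$ and every $x\in\mathbb{B}\setminus\{0\}$, \[ \left\|\frac{D^3F(0)(x^3)}{3!}-\lambda\,\frac12\, D^2F(0)\!\left(x,\frac{D^2F(0)(x^2)}{2!}\right)\right\|\le \frac{\|x\|^3}{2}\,\psi_\beta(\lambda)\,|g'(0)|, \] where \[ \psi_\beta(\lambda)=\cos\beta\cdot\max\left\{1,\ \left|(1-2\lambda)\cos\beta\, g'(0)+\frac{e^{i\beta}}{2}\cdot\frac{g''(0)}{g'(0)}\right|\right\}. \] Moreover, this estimate is sharp.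
   Context: $X^*$ denotes the dual space of $X$. For $x\in X\setminus\{0\}$, $T(x)=\{T_x\in X^*:\ \|T_x\|=1,\ T_x(x)=\|x\|\}$ (nonempty by Hahn–Banach). $D^nF(0)$ denotes the $n$-th Fréchet derivative of $F$ at $0$, a bounded symmetric $n$-linear map, and $D^nF(0)(x^n)=D^nF(0)[x,\dots,x]$. With $g$ as in the claim, put $g_\beta(z)=e^{-i\beta}\left(\cos\beta\, g(z)+i\sin\beta\right)$ for $z\in\mathbb{U}$. The class $\widehat{\mathcal{M}}_g(\beta)$ consists of all holomorphic mappings $h:\mathbb{B}\to X$ such that $\frac{\|x\|}{T_x(h(x))}\in g_\beta(\mathbb{U})$ for all $x\in\mathbb{B}\setminus\{0\}$ and all $T_x\in T(x)$. *)

(* Defs.v *)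
From HB Require Import structures.
From mathcomp Require Import all_boot all_order all_algebra.
From mathcomp Require Import complex.
From mathcomp Require Import all_classical all_reals all_analysis.
Set Implicit Arguments. Unset Strict Implicit. Unset Printing Implicit Defensive.
Import Order.TTheory GRing.Theory Num.Theory.
Import numFieldNormedType.Exports.
Local Open Scope ring_scope.
Local Open Scope classical_set_scope.

(* The complex field C = R[i], seen as a numClosedFieldType (hence a
   normed module over itself). *)
Definition Cpx (R : realType) : numClosedFieldType := R[i].

Definition RtoC {R : realType} (r : R) : Cpx R := (r%:C)%C.

Definition unit_disk {R : realType} : set (Cpx R) := [set z | `|z| < 1].

Definition unit_ball {R : realType} {X : normedModType (Cpx R)} : set X :=
  [set x | `|x| < 1].

Definition holomorphic_on {R : realType} {V W : normedModType (Cpx R)}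
  (D : set V) (f : V -> W) : Prop :=
  forall x, D x -> differentiable f x.

Definition biholomorphic_on {R : realType} (D : set (Cpx R))
  (f : Cpx R -> Cpx R) : Prop :=
  [/\ holomorphic_on D f,
      (forall z w, D z -> D w -> f z = f w -> z = w) &
      exists finv : Cpx R -> Cpx R,
        (forall z, D z -> finv (f z) = z) /\ holomorphic_on (f @` D) finv].

(* T(x): continuous linear functionals T on X with ||T|| = 1 and
   T x = ||x||.  ||T|| = 1 is written out as: 1 is the least constant
   c >= 0 with |T y| <= c ||y|| for all y. *)
Definition support_functionals {R : realType} {X : normedModType (Cpx R)}
  (x : X) : set {linear X -> Cpx R} :=
  [set T | [/\ (forall y, `|T y| <= `|y|),
              (forall c : Cpx R, 0 <= c -> (forall y, `|T y| <= c * `|y|) ->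
                 1 <= c) &
              T x = `|x| ]].

(* g_beta(z) = e^{-i beta} (cos beta g(z) + i sin beta),
   with e^{-i beta} = cos beta - i sin beta *)
Definition g_beta {R : realType} (g : Cpx R -> Cpx R) (b : R) (z : Cpx R)
  : Cpx R :=
  (RtoC (cos b) - 'i * RtoC (sin b)) * (RtoC (cos b) * g z + 'i * RtoC (sin b)).

Definition M_hat {R : realType} {X : normedModType (Cpx R)}
  (g : Cpx R -> Cpx R) (b : R) : set (X -> X) :=
  [set h | holomorphic_on unit_ball h /\
     forall x : X, unit_ball x -> x != 0 ->
       forall T, support_functionals x T ->
         (g_beta g b @` unit_disk) (`|x| / T (h x))].

Definition one_dim_type {R : realType} {X : normedModType (Cpx R)}
  (F : X -> X) : Prop :=
  exists f : X -> Cpx R, holomorphic_on unit_ball f /\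
    forall x, unit_ball x -> F x = f x *: x.

Definition DF_invertible {R : realType} {X : normedModType (Cpx R)}
  (F : X -> X) (x : X) : Prop :=
  exists L : {linear X -> X}, [/\ continuous L,
     (forall v, L ('d F x v) = v) & (forall v, 'd F x (L v) = v)].

(* (DF(x))^{-1} F(x) belongs to \hat{M}_g(beta): the map h with
   DF(x) h(x) = F(x) on B (unique, as DF(x) is invertible) is in the class *)
Definition DFinvF_in_class {R : realType} {X : normedModType (Cpx R)}
  (g : Cpx R -> Cpx R) (b : R) (F : X -> X) : Prop :=
  exists h : X -> X, (forall x, unit_ball x -> 'd F x (h x) = F x) /\
    M_hat g b h.

Definition admissible {R : realType} {X : normedModType (Cpx R)}
  (g : Cpx R -> Cpx R) (b : R) (F : X -> X) : Prop :=
  holomorphic_on unit_ball F /\ one_dim_type F /\ F 0 = 0 /\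
  (forall v, 'd F 0 v = v) /\
  (forall x, unit_ball x -> DF_invertible F x) /\
  DFinvF_in_class g b F.

(* higher Frechet derivatives at a, applied to vectors, written as
   iterated (complex) directional derivatives *)
Definition D2 {R : realType} {X : normedModType (Cpx R)} (F : X -> X)
  (a u v : X) : X :=
  derive (fun p => derive F p u) a v.
Definition D3 {R : realType} {X : normedModType (Cpx R)} (F : X -> X)
  (a u v w : X) : X :=
  derive (fun p => D2 F p u v) a w.

Definition dg1 {R : realType} (g : Cpx R -> Cpx R) : Cpx R := derive g 0 1.
Definition dg2 {R : realType} (g : Cpx R -> Cpx R) : Cpx R :=
  derive (fun z => derive g z 1) 0 1.

Definition psi_beta {R : realType} (g : Cpx R -> Cpx R) (b : R)
  (lam : Cpx R) : Cpx R :=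
  RtoC (cos b) * Num.max 1
    `| (1 - 2 * lam) * RtoC (cos b) * dg1 g
       + (RtoC (cos b) + 'i * RtoC (sin b)) / 2 * (dg2 g / dg1 g) |.

Definition FS_functional {R : realType} {X : normedModType (Cpx R)}
  (F : X -> X) (lam : Cpx R) (x : X) : X :=
  ((3`!)%:R^-1 : Cpx R) *: D3 F 0 x x x
  - (lam * 2^-1) *: D2 F 0 x (((2`!)%:R^-1 : Cpx R) *: D2 F 0 x x).

(* Main.v *)
Require Import Defs.
From HB Require Import structures.
From mathcomp Require Import all_boot all_order all_algebra.
From mathcomp Require Import complex.
From mathcomp Require Import all_classical all_reals all_analysis.
From mathcomp Require Import ring lra.
Import Order.TTheory GRing.Theory Num.Theory.
Import numFieldNormedType.Exports.
Local Open Scope ring_scope.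
Local Open Scope classical_set_scope.
Set Implicit Arguments. Unset Strict Implicit. Unset Printing Implicit Defensive.
(** Along a complex line through the origin a mapping [F x = f x *: x] reduces to the
    one-variable function [P t = t * phi t], and membership in the class says that
    [t P'(t) / P(t) = 1 + k (g (w t) - 1)] with [k = exp(-i beta) cos beta] and [w] a
    holomorphic self-map of the disk fixing [0] (norming functionals come from
    Hahn-Banach). Comparing Taylor coefficients, the functional equals
    [(k g'(0) / 2) (w2 + mu w1^2)], with [|mu|] the second term of the maximum, and the
    bound follows from [|w2| <= 1 - |w1|^2]. Equality is attained for [w t = t] or
    [w t = t^2], by solving for [phi] as the exponential of a primitive and taking
    [F x = phi (T x) *: x] with [T] norming.

    The one-variable theory rests on Goursat's lemma, proved for limits of dyadic
    midpoint sums, and the resulting primitives on convex domains. A primitive of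
    [k (exp s)] on the left half-plane replaces circle integrals; this yields the mean
    value property, Cauchy's estimate for the first derivative, and, through difference
    quotients, the differentiability of derivatives. *)

(** The maximum in the bound and the two extremal choices of [w] have one origin: under
    [|w2| <= 1 - |w1|^2] the modulus [|w2 + mu w1^2|] is at most [(1 - |w1|^2) + |mu| |w1|^2],
    affine in [|w1|^2], hence largest at an endpoint, and [w t = t^2] and [w t = t] realise the
    endpoints. The one-dimensional type is what makes a single line sufficient: [D^2F(0)(x, x)] is
    again a multiple of [x], so the nested term of the functional is evaluated on the same line.
    Cauchy's estimate and the coefficient inequality both come from one positivity fact: a function
    on the punctured disk with a pole of order at most two at [0] and nonnegative real part on a
    circle about [0] has a constant Laurent term with nonnegative real part. Order two is dictated
    by the second Taylor coefficient of [w]. Midpoint sums suit Goursat's argument because they are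
    additive under bisection by definition and exact on affine functions. *)

Section RealNorm.
Context {R : realType}.
Local Notation C := (Cpx R).

(** The norm of a module over [Cpx R] is itself an element of [Cpx R], ordered only partially; its
    value is real, so passing to the real part loses nothing and opens all estimates to real linear
    arithmetic. *)
Definition nm {V : normedModType C} (x : V) : R := complex.Re (`|x| : C).

Lemma nmE {V : normedModType C} (x : V) : `|x| = RtoC (nm x).
Proof. by rewrite /nm /RtoC RRe_real // normr_real. Qed.

Lemma RtoC_le (x y : R) : (RtoC x <= RtoC y) = (x <= y).
Proof. exact: lecR. Qed.

Lemma RtoC_lt (x y : R) : (RtoC x < RtoC y) = (x < y).
Proof. exact: ltcR. Qed.

Lemma RtoCD (x y : R) : RtoC (x + y) = RtoC x + RtoC y.
Proof. exact: (rmorphD (real_complex R)). Qed.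

Lemma RtoCN (x : R) : RtoC (- x) = - RtoC x.
Proof. exact: (rmorphN (real_complex R)). Qed.

Lemma RtoCB (x y : R) : RtoC (x - y) = RtoC x - RtoC y.
Proof. exact: (rmorphB (real_complex R)). Qed.

Lemma RtoCM (x y : R) : RtoC (x * y) = RtoC x * RtoC y.
Proof. exact: (rmorphM (real_complex R)). Qed.

Lemma RtoCV (x : R) : RtoC (x^-1) = (RtoC x)^-1.
Proof. exact: (fmorphV (real_complex R)). Qed.

Lemma RtoCX (x : R) n : RtoC (x ^+ n) = (RtoC x) ^+ n.
Proof. exact: (rmorphXn (real_complex R)). Qed.

Lemma RtoC1 : RtoC (1 : R) = 1. Proof. by []. Qed.
Lemma RtoC0 : RtoC (0 : R) = 0. Proof. by []. Qed.
Lemma RtoC_nat n : RtoC (n%:R : R) = n%:R.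
Proof. exact: (rmorph_nat (real_complex R)). Qed.
Lemma RtoC_inj : injective (@RtoC R). Proof. by move=> x y []. Qed.
Lemma RtoC_eq0 (x : R) : (RtoC x == 0) = (x == 0).
Proof. exact: (fmorph_eq0 (real_complex R)). Qed.

Lemma nm_ge0 {V : normedModType C} (x : V) : 0 <= nm x.
Proof. by rewrite -RtoC_le -nmE RtoC0 normr_ge0. Qed.
Hint Resolve nm_ge0 : core.

Lemma nm0 {V : normedModType C} : nm (0 : V) = 0.
Proof. by apply: RtoC_inj; rewrite -nmE normr0. Qed.

Lemma nm_eq0 {V : normedModType C} (x : V) : (nm x == 0) = (x == 0).
Proof. by rewrite -RtoC_eq0 -nmE normr_eq0. Qed.

Lemma nm_gt0 {V : normedModType C} (x : V) : (0 < nm x) = (x != 0).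
Proof. by rewrite -RtoC_lt -nmE RtoC0 normr_gt0. Qed.

Lemma nmD {V : normedModType C} (x y : V) : nm (x + y) <= nm x + nm y.
Proof. by rewrite -RtoC_le RtoCD -!nmE ler_normD. Qed.

Lemma nmN {V : normedModType C} (x : V) : nm (- x) = nm x.
Proof. by apply: RtoC_inj; rewrite -!nmE normrN. Qed.

Lemma nmB {V : normedModType C} (x y : V) : nm (x - y) <= nm x + nm y.
Proof. by rewrite -(nmN y) nmD. Qed.

Lemma nm_subC {V : normedModType C} (x y : V) : nm (x - y) = nm (y - x).
Proof. by rewrite -nmN opprB. Qed.

Lemma nmBD {V : normedModType C} (z x y : V) : nm (x - y) <= nm (x - z) + nm (z - y).
Proof. by rewrite (le_trans _ (nmD _ _)) // addrA subrK. Qed.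

Lemma nmZ {V : normedModType C} (c : C) (x : V) : nm (c *: x) = nm c * nm x.
Proof. by apply: RtoC_inj; rewrite RtoCM -!nmE normrZ. Qed.

Lemma nmM (x y : C) : nm (x * y) = nm x * nm y.
Proof. by apply: RtoC_inj; rewrite RtoCM -!nmE normrM. Qed.

Lemma nmX (x : C) n : nm (x ^+ n) = nm x ^+ n.
Proof. by apply: RtoC_inj; rewrite RtoCX -!nmE normrX. Qed.

Lemma nmV (x : C) : nm x^-1 = (nm x)^-1.
Proof. by apply: RtoC_inj; rewrite RtoCV -!nmE normfV. Qed.

Lemma nm_RtoC (x : R) : nm (RtoC x) = `|x|.
Proof.
apply: RtoC_inj; rewrite -nmE; case: (lerP 0 x) => hx.
  by rewrite !ger0_norm // RtoC_le.
by rewrite !ltr0_norm ?RtoCN // -RtoC0 RtoC_lt.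
Qed.

Lemma nm1 : nm (1 : C) = 1.
Proof. by apply: RtoC_inj; rewrite -nmE normr1. Qed.

Lemma nm_half : nm (2^-1 : C) = 2^-1.
Proof. by rewrite -RtoC_nat -RtoCV nm_RtoC ger0_norm // invr_ge0. Qed.

Lemma nm_sqr (z : C) : nm z ^+ 2 = complex.Re z ^+ 2 + complex.Im z ^+ 2.
Proof. by apply: RtoC_inj; rewrite RtoCX -nmE -add_Re2_Im2. Qed.

Lemma Re_le_nm (z : C) : `|complex.Re z| <= nm z.
Proof. by rewrite -ler_sqr ?nnegrE // nm_sqr real_normK ?num_real // lerDl sqr_ge0. Qed.

Lemma Im_le_nm (z : C) : `|complex.Im z| <= nm z.
Proof. by rewrite -ler_sqr ?nnegrE // nm_sqr real_normK ?num_real // lerDr sqr_ge0. Qed.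

Lemma nm_le_ReIm (z : C) : nm z <= `|complex.Re z| + `|complex.Im z|.
Proof.
rewrite -ler_sqr ?nnegrE ?addr_ge0 // nm_sqr sqrrD !real_normK ?num_real //.
by rewrite lerD2r lerDl mulrn_wge0 // mulr_ge0.
Qed.

Lemma cReD (x y : C) : complex.Re (x + y) = complex.Re x + complex.Re y.
Proof. by case: x y => [a b] [c d]. Qed.
Lemma cImD (x y : C) : complex.Im (x + y) = complex.Im x + complex.Im y.
Proof. by case: x y => [a b] [c d]. Qed.
Lemma cReN (x : C) : complex.Re (- x) = - complex.Re x.
Proof. by case: x. Qed.
Lemma cImN (x : C) : complex.Im (- x) = - complex.Im x.
Proof. by case: x. Qed.
Lemma cReM (x y : C) : complex.Re (x * y) =
  complex.Re x * complex.Re y - complex.Im x * complex.Im y.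
Proof. by case: x y => [a b] [c d]. Qed.
Lemma cImM (x y : C) : complex.Im (x * y) =
  complex.Re x * complex.Im y + complex.Im x * complex.Re y.
Proof. by case: x y => [a b] [c d]. Qed.
Lemma cReMl (r : R) (x : C) : complex.Re (RtoC r * x) = r * complex.Re x.
Proof. by rewrite cReM /= mul0r subr0. Qed.
Lemma cImMl (r : R) (x : C) : complex.Im (RtoC r * x) = r * complex.Im x.
Proof. by rewrite cImM /= mul0r addr0. Qed.
Lemma cRe_i : complex.Re ('i : C) = 0.
Proof. by rewrite -complexiE. Qed.
Lemma cIm_i : complex.Im ('i : C) = 1.
Proof. by rewrite -complexiE. Qed.
Lemma C_eq (x y : C) : complex.Re x = complex.Re y ->
  complex.Im x = complex.Im y -> x = y.
Proof. by case: x y => [a b] [c d] /= -> ->. Qed.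

Lemma complexRI (z : C) : z = RtoC (complex.Re z) + 'i * RtoC (complex.Im z).
Proof. by apply: C_eq; rewrite ?cReD ?cImD ?cReM ?cImM cRe_i cIm_i /=; ring. Qed.

Lemma nm_i : nm ('i : C) = 1.
Proof.
apply/eqP; rewrite -(@eqrXn2 _ 2) // ?nm_ge0 // expr1n nm_sqr cRe_i cIm_i.
by rewrite expr0n expr1n add0r.
Qed.

(** Turns bounds on moduli into bounds on real parts, the form in which the real mean value theorem
    and the positivity arguments deliver them. *)
Lemma nm_rotate (z : C) : exists2 u : C, nm u = 1 & u * z = RtoC (nm z).
Proof.
have [->|z0] := eqVneq z 0; first by exists 1; rewrite ?nm1 // mulr0 nm0.
have nz : nm z != 0 by rewrite nm_eq0.
exists (RtoC (nm z) / z); last by rewrite divfK.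
by rewrite nmM nmV nm_RtoC ger0_norm // divff.
Qed.

Lemma nm_le_rot (z : C) (M : R) :
  (forall u : C, nm u = 1 -> complex.Re (u * z) <= M) -> nm z <= M.
Proof. by move=> H; have [u u1 e] := nm_rotate z; have := H u u1; rewrite e. Qed.

(** * Neighbourhoods and complex derivatives in epsilon-delta form with real radii *)

Lemma nearC {V : normedModType C} (x : V) (P : V -> Prop) :
  (\forall y \near x, P y) <->
  exists2 d : R, 0 < d & forall h, nm h < d -> P (x + h).
Proof.
split=> [/nbhs_normP[e /= e0 He]|[d d0 Hd]].
  have er : e \is Num.real by rewrite gtr0_real.
  have ee : e = RtoC (complex.Re e) by rewrite /RtoC RRe_real.
  exists (complex.Re e); first by rewrite -RtoC_lt -ee.
  move=> h hd; apply: He => /=.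
  by rewrite opprD addrA subrr sub0r normrN nmE ee RtoC_lt.
apply/nbhs_normP; exists (RtoC d) => /=; first by rewrite -RtoC0 RtoC_lt.
move=> y /=; rewrite nmE RtoC_lt => yd.
by rewrite -[y](subrK x) addrC; apply: Hd; rewrite nm_subC.
Qed.

(** Multiplied out instead of a limit of quotients: there is no division and [h = 0] need not be
    excluded, so composition and locality are plain estimates. *)
Definition cder (f : C -> C) (z l : C) : Prop :=
  forall e : R, 0 < e -> exists2 d : R, 0 < d &
    forall h, nm h < d -> nm (f (z + h) - f z - l * h) <= e * nm h.

Lemma cvgC {T : Type} {F : set_system T} {FF : Filter F} {V : normedModType C}
  (f : T -> V) (l : V) :
  f @ F --> l <-> forall e : R, 0 < e -> \forall t \near F, nm (f t - l) <= e.
Proof.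
rewrite cvgrPdist_le; split=> H e e0.
  have := H (RtoC e); rewrite -{1}RtoC0 RtoC_lt => /(_ e0).
  by apply: filterS => t; rewrite nmE RtoC_le nm_subC.
have er : e \is Num.real by rewrite gtr0_real.
have ee : e = RtoC (complex.Re e) by rewrite /RtoC RRe_real.
have /H : 0 < complex.Re e by rewrite -RtoC_lt -ee.
by apply: filterS => t; rewrite ee nmE RtoC_le nm_subC.
Qed.

Lemma cderP (f : C -> C) (z l : C) : cder f z l <-> is_derive z 1 f l.
Proof.
have qE h : h != 0 :> C ->
  h^-1 *: ((f \o shift z) (h *: 1) - f z) - l = h^-1 * (f (z + h) - f z - l * h).
  move=> h0 /=; rewrite [h *: 1]mulr1 [_ *: _]/(_ * _) (addrC h) mulrBr.
  by rewrite (mulrC l) mulKf.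
suff E : cder f z l <->
    (fun h => h^-1 *: ((f \o shift z) (h *: 1) - f z)) @ 0^' --> l.
  rewrite E; split=> [H|[H1 H2]]; last by rewrite -H2.
  by split; [apply/cvg_ex; exists l | exact: cvg_lim H].
rewrite cvgC; split=> H e e0.
  have [d d0 Hd] := H e e0.
  rewrite near_withinE; apply/(nearC (0 : C)); exists d => // h hd; rewrite add0r => h0.
  rewrite qE // nmM nmV ler_pdivrMl ?nm_gt0 // [nm h * e]mulrC; exact: Hd.
have := H e e0; rewrite near_withinE => /(nearC (0 : C))[d d0 Hd].
exists d => // h hd; have [->|h0] := eqVneq h 0.
  by rewrite addr0 subrr sub0r mulr0 oppr0 nm0 mulr0.
have := Hd h hd; rewrite add0r => /(_ h0); rewrite qE // nmM nmV.
by rewrite ler_pdivrMl ?nm_gt0 // [nm h * e]mulrC.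
Qed.

Lemma differentiable_cder (f : C -> C) (z : C) :
  differentiable f z -> cder f z ('D_1 f z).
Proof. by move=> df; apply/cderP; split=> //; apply/derivable1_diffP. Qed.

Lemma cder_val (f : C -> C) (z l : C) : cder f z l -> 'D_1 f z = l.
Proof. by move=> /cderP df; exact: derive_val. Qed.

Lemma cder_uniq (f : C -> C) (z l m : C) : cder f z l -> cder f z m -> l = m.
Proof. by move=> /cder_val <- /cder_val. Qed.

Lemma cder_near (f g : C -> C) (z l : C) (d : R) : 0 < d ->
  (forall h, nm h < d -> f (z + h) = g (z + h)) -> cder f z l -> cder g z l.
Proof.
move=> d0 E H e e0; have [d' d'0 H'] := H e e0.
exists (Num.min d d'); first by rewrite lt_min d0.
move=> h; rewrite lt_min => /andP[h1 h2].
rewrite -E // -[z in g z]addr0 -E ?nm0 // addr0; exact: H'.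
Qed.

Lemma cder_cst (c z : C) : cder (fun=> c) z 0.
Proof.
move=> e e0; exists 1 => // h _.
by rewrite subrr mul0r subr0 nm0 mulr_ge0 // ltW.
Qed.

Lemma cder_id (z : C) : cder (fun z => z) z 1.
Proof.
move=> e e0; exists 1 => // h _.
by rewrite mul1r (addrC z) addrK subrr nm0 mulr_ge0 // ltW.
Qed.

Lemma cderD (f g : C -> C) (z l m : C) : cder f z l -> cder g z m ->
  cder (fun z => f z + g z) z (l + m).
Proof. by move=> /cderP Hf /cderP Hg; apply/cderP; exact: is_deriveD. Qed.

Lemma cderN (f : C -> C) (z l : C) : cder f z l ->
  cder (fun z => - f z) z (- l).
Proof. by move=> /cderP Hf; apply/cderP; exact: is_deriveN. Qed.

Lemma cderB (f g : C -> C) (z l m : C) : cder f z l -> cder g z m ->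
  cder (fun z => f z - g z) z (l - m).
Proof. by move=> Hf Hg; apply: cderD => //; exact: cderN. Qed.

Lemma cderM (f g : C -> C) (z l m : C) : cder f z l -> cder g z m ->
  cder (fun z => f z * g z) z (l * g z + f z * m).
Proof.
move=> /cderP Hf /cderP Hg; apply/cderP.
apply: is_derive_eq; rewrite addrC; congr (_ + _); exact: mulrC.
Qed.

Lemma cderZ (f : C -> C) (c z l : C) : cder f z l ->
  cder (fun z => c * f z) z (c * l).
Proof.
by move=> Hf; have := cderM (cder_cst c z) Hf; rewrite mul0r add0r.
Qed.

Lemma cder_comp (f g : C -> C) (z l m : C) : cder f z l -> cder g (f z) m ->
  cder (fun z => g (f z)) z (m * l).
Proof.
move=> Hf Hg e e0.
have L0 : 0 < nm l + 1 by rewrite ltr_wpDl.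
have M0 : 0 < nm m + 1 by rewrite ltr_wpDl.
(* The error at [h] is the remainder of [g] at the increment [k] plus [m] times the remainder of
   [f], each allotted [e / 2]. The minimum with [1] below also yields [|k| <= (|l| + 1) |h|]. *)
have e10 : 0 < e / 2 / (nm l + 1) by rewrite !divr_gt0.
have e20 : 0 < Num.min 1 (e / 2 / (nm m + 1)) by rewrite lt_min ltr01 !divr_gt0.
have [d1 d10 H1] := Hg _ e10; have [d2 d20 H2] := Hf _ e20.
exists (Num.min d2 (d1 / (nm l + 1))); first by rewrite lt_min d20 divr_gt0.
move=> h; rewrite lt_min => /andP[h2]; rewrite ltr_pdivlMr // => h1.
have := H2 h h2; set k := f (z + h) - f z => Hk.
have Hk1 : nm (k - l * h) <= nm h.
  by rewrite (le_trans Hk) // ler_piMl // ge_min lexx.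
have Hk2 : nm (k - l * h) <= e / 2 / (nm m + 1) * nm h.
  by rewrite (le_trans Hk) // ler_wpM2r // ge_min lexx orbT.
have kh : nm k <= nm h * (nm l + 1).
  rewrite -[k](subrK (l * h)) (le_trans (nmD _ _)) // nmM.
  by rewrite mulrDr mulr1 addrC (mulrC (nm h)) lerD2l.
have := H1 k (le_lt_trans kh h1).
have -> : f z + k = f (z + h) by rewrite /k addrC subrK.
move=> Hg1.
have -> : g (f (z + h)) - g (f z) - m * l * h =
  (g (f (z + h)) - g (f z) - m * k) + m * (k - l * h) by ring.
rewrite (le_trans (nmD _ _)) // nmM [e]splitr mulrDl lerD //.
  by rewrite (le_trans Hg1) // (le_trans (ler_wpM2l (ltW e10) kh)) // (mulrC (nm h))
    mulrA divfK ?gt_eqF.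
rewrite (le_trans (ler_wpM2l _ Hk2)) // mulrA ler_wpM2r // mulrC.
by rewrite mulrAC ler_pdivrMr // ler_wpM2l ?divr_ge0 ?ltW // ltrDl.
Qed.

Lemma cder_inv (a : C) : a != 0 -> cder (fun z => z^-1) a (- (a ^+ 2)^-1).
Proof.
move=> a0 e e0; have na : 0 < nm a by rewrite nm_gt0.
(* The remainder equals [h * (h / (a^2 (a + h)))], and [|a + h| >= |a| / 2] within this radius. *)
exists (Num.min (nm a / 2) (e * nm a ^+ 3 / 2)).
  by rewrite lt_min !divr_gt0 // mulr_gt0 // exprn_gt0.
move=> h; rewrite lt_min => /andP[h1 h2].
have ah : nm a / 2 <= nm (a + h).
  have := nmB (a + h) h; rewrite addrK; lra.
have ah0 : 0 < nm (a + h) by apply: lt_le_trans ah; rewrite divr_gt0.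
have ah0' : a + h != 0 by rewrite -nm_gt0.
have -> : (a + h)^-1 - a^-1 - - (a ^+ 2)^-1 * h = h * (h / (a ^+ 2 * (a + h))).
  by field; rewrite ah0' a0.
rewrite nmM mulrC ler_wpM2r // nmM nmV nmM nmX ler_pdivrMr; last first.
  by rewrite mulr_gt0 // exprn_gt0.
apply: (le_trans (ltW h2)).
have -> : e * nm a ^+ 3 / 2 = e * (nm a ^+ 2 * (nm a / 2)) by field.
by apply: ler_wpM2l; [exact: ltW|rewrite ler_wpM2l // sqr_ge0].
Qed.

Lemma cderV (f : C -> C) (z l : C) : f z != 0 -> cder f z l ->
  cder (fun z => (f z)^-1) z (- l / f z ^+ 2).
Proof.
move=> fz Hf; have := cder_comp Hf (cder_inv fz).
by rewrite mulNr mulrC -mulNr.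
Qed.

Lemma cder_cont (f : C -> C) (z l : C) : cder f z l ->
  forall e : R, 0 < e -> exists2 d : R, 0 < d &
    forall h, nm h < d -> nm (f (z + h) - f z) <= e.
Proof.
move=> H e e0; have [d d0 Hd] := H 1 ltr01.
have L0 : 0 < 1 + nm l by rewrite ltr_pwDl.
exists (Num.min d (e / (1 + nm l))); first by rewrite lt_min d0 divr_gt0.
move=> h; rewrite lt_min => /andP[h1]; rewrite ltr_pdivlMr // => h2.
apply: le_trans (ltW h2).
rewrite -[f _ - _](subrK (l * h)) (le_trans (nmD _ _)) // mulrDr mulr1 nmM.
by rewrite (mulrC (nm h)) lerD2r -[nm h]mul1r; exact: Hd.
Qed.

End RealNorm.
#[global] Hint Extern 0 (is_true (0 <= nm _)) => solve [apply: nm_ge0] : core.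

(** * Integrals along segments, Goursat's lemma and primitives *)

Section Goursat.
Context {R : realType}.
Local Notation C := (Cpx R).
Implicit Types (f g : C -> C) (a b c z : C) (K : C -> Prop).

Lemma real_cauchy_cvg (u : nat -> R) :
  (forall e : R, 0 < e -> exists N, forall p q, (N <= p)%N -> (N <= q)%N ->
     `|u p - u q| <= e) -> exists l : R, u @ \oo --> l.
Proof.
move=> H; suff /cvg_ex : cvgn u by [].
apply/cauchy_cvgP/cauchy_exP => e e0.
have e20 : 0 < e / 2 by rewrite divr_gt0.
have [N HN] := H _ e20; exists (u N); exists N => // n /= Nn.
by rewrite /ball /= (le_lt_trans (HN _ _ _ _)) // ltr_pdivrMr // ltr_pMr // ltr1n.
Qed.

Lemma cauchyC (u : nat -> C) :
  (forall e : R, 0 < e -> exists N, forall p q, (N <= p)%N -> (N <= q)%N ->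
     nm (u p - u q) <= e) -> exists l : C, u @ \oo --> l.
Proof.
move=> H.
have [x Hx] : exists x : R, (fun n => complex.Re (u n)) @ \oo --> x.
  apply: real_cauchy_cvg => e e0; have [N HN] := H e e0; exists N => p q hp hq.
  by rewrite -cReN -cReD (le_trans (Re_le_nm _)) // HN.
have [y Hy] : exists y : R, (fun n => complex.Im (u n)) @ \oo --> y.
  apply: real_cauchy_cvg => e e0; have [N HN] := H e e0; exists N => p q hp hq.
  by rewrite -cImN -cImD (le_trans (Im_le_nm _)) // HN.
exists (RtoC x + 'i * RtoC y); apply/cvgC => e e0.
have e20 : 0 < e / 2 by rewrite divr_gt0.
move/cvgrPdist_le : Hx => /(_ _ e20) Hx; move/cvgrPdist_le : Hy => /(_ _ e20) Hy.
near=> n; rewrite (le_trans (nm_le_ReIm _)) // [leRHS]splitr.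
rewrite !(cReD, cImD, cReN, cImN, cReM, cImM) cRe_i cIm_i /= !(mul0r, mul1r, mulr0, addr0, add0r, subr0).
by apply: lerD; rewrite distrC; near: n.
Unshelve. all: by end_near. Qed.

Lemma lim_nm_le (u : nat -> C) (l c : C) (B : R) : u @ \oo --> l ->
  (forall n, nm (u n - c) <= B) -> nm (l - c) <= B.
Proof.
move=> ul Hu; apply/ler_addgt0Pr => e e0.
have /cvgC /(_ e e0) [N _ HN] := ul.
rewrite (le_trans (nmBD (u N) _ _)) // addrC lerD // nm_subC; exact: HN (leqnn _).
Qed.

Definition nm_closed K :=
  forall z, (forall e : R, 0 < e -> exists2 w, K w & nm (w - z) <= e) -> K z.

Definition mid a b : C := (a + b) / 2.

(** Stability under midpoints is enough, since bisection produces no other points. *)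
Definition midconvex K := forall a b, K a -> K b -> K (mid a b).

Lemma two_neq0 : (2 : C) != 0. Proof. by rewrite pnatr_eq0. Qed.
Hint Resolve two_neq0 : core.

(** Nested bisection, kept abstract so that it serves both the convergence of midpoint sums on
    segments and Goursat's estimate on triangles. A failing piece has a failing child; sizes halve,
    so the representatives converge to a point of [K], where the local hypothesis is contradicted.
    The factor [2] is the sum of the geometric series of sizes. *)
Lemma cousin (T : Type) (rep : T -> C) (size : T -> R) (child : T -> T -> Prop)
    (K : C -> Prop) (P : T -> Prop) :
  nm_closed K -> (forall t, ~ P t -> K (rep t)) ->
  (forall t, 0 <= size t) ->
  (forall t t', child t t' -> nm (rep t' - rep t) <= size t /\ size t' = size t / 2) ->
  (forall t, ~ P t -> exists2 t', child t t' & ~ P t') ->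
  (forall z, K z -> exists2 d : R, 0 < d &
     forall t, nm (rep t - z) <= 2 * size t -> size t < d -> P t) ->
  forall t, P t.
Proof.
move=> Kcl PK s0 Hc Hs Hl t0; apply: contrapT => nP0.
have /choice[nxt Hnxt] : forall t, exists t', ~ P t -> child t t' /\ ~ P t'.
  move=> t; have [Pt|nPt] := pselect (P t); first by exists t.
  by have [t' c1 c2] := Hs _ nPt; exists t'.
pose s n := iter n nxt t0.
have nPs n : ~ P (s n) by elim: n => //= n IH; have [] := Hnxt _ IH.
have cs n : child (s n) (s n.+1) by have [] := Hnxt _ (nPs n).
have szS n : size (s n.+1) = size (s n) / 2 by have [] := Hc _ _ (cs n).
have sz n : size (s n) = size t0 / 2 ^+ n.
  elim: n => [|n IH]; first by rewrite expr0 divr1.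
  by rewrite szS IH exprSr invfM mulrA.
have dst n p : nm (rep (s (n + p)%N) - rep (s n)) <= 2 * size (s n).
  (* Subtracting the size that remains makes the bound telescope, so that the induction on [p]
     closes. *)
  suff: nm (rep (s (n + p)%N) - rep (s n)) <= 2 * (size (s n) - size (s (n + p)%N)).
    by move=> h; rewrite (le_trans h) // mulrBr gerBl mulr_ge0.
  elim: p => [|p IH]; first by rewrite addn0 !subrr mulr0 nm0.
  rewrite addnS (le_trans (nmBD (rep (s (n + p)%N)) _ _)) //.
  have [h _] := Hc _ _ (cs (n + p)%N).
  by move: (szS (n + p)%N) h IH => ->; lra.
have small (e : R) : 0 < e -> exists n, size (s n) < e.
  move=> e0.
  have /cvgrPdist_lt /(_ e e0) [N _ HN] : (fun n => size t0 * (2^-1) ^+ n) @ \oo --> (0 : R).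
    rewrite -(mulr0 (size t0)); apply: cvgMr; apply: cvg_expr.
    by rewrite gtr0_norm ?invr_gt0 // invf_lt1 // ltr1n.
  exists N; have := HN N (leqnn _); rewrite sub0r normrN sz exprVn => h.
  exact: le_lt_trans (ler_norm _) h.
have szle n p : size (s (n + p)%N) <= size (s n).
  elim: p => [|p IH]; first by rewrite addn0.
  by rewrite addnS szS; have := s0 (s (n + p)%N); lra.
have [z Hz] : exists z : C, (fun n => rep (s n)) @ \oo --> z.
  apply: cauchyC => e e0; have e40 : 0 < e / 4 by rewrite divr_gt0.
  have [N HN] := small _ e40; exists N => p q /subnKC <- /subnKC <-.
  rewrite (le_trans (nmBD (rep (s N)) _ _)) // (nm_subC (rep (s N))).
  by have := dst N (p - N)%N; have := dst N (q - N)%N; lra.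
have dz n : nm (rep (s n) - z) <= 2 * size (s n).
  rewrite nm_subC; apply: (@lim_nm_le (fun p => rep (s (p + n)%N))) => [|p].
    exact: cvg_comp (@cvg_addnr n) Hz.
  by rewrite addnC dst.
have Kz : K z.
  apply: Kcl => e e0; have e20 : 0 < e / 2 by rewrite divr_gt0.
  have [n hn] := small _ e20; exists (rep (s n)); first exact/PK/nPs.
  by rewrite (le_trans (dz n)) //; lra.
have [d d0 Hd] := Hl _ Kz; have [n hn] := small _ d0.
by apply: (nPs n); apply: Hd.
Qed.

(** Midpoint rule on [2 ^ n] equal pieces. Recursing on halves makes additivity under bisection hold
    by computation; in the limit it is a mere shift of the index. *)
Fixpoint msum f n a b : C :=
  if n is n'.+1 then msum f n' a (mid a b) + msum f n' (mid a b) b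
  else f (mid a b) * (b - a).

Lemma midC a b : mid a b = mid b a.
Proof. by rewrite /mid addrC. Qed.

Lemma mid_subl a b : mid a b - a = (b - a) / 2.
Proof. by rewrite /mid; field. Qed.

Lemma mid_subr a b : b - mid a b = (b - a) / 2.
Proof. by rewrite /mid; field. Qed.

Lemma nm_midl a b : nm (mid a b - a) = nm (b - a) / 2.
Proof. by rewrite mid_subl nmM nm_half. Qed.

Lemma nm_midr a b : nm (b - mid a b) = nm (b - a) / 2.
Proof. by rewrite mid_subr nmM nm_half. Qed.

Lemma msum_rev f n a b : msum f n b a = - msum f n a b.
Proof.
elim: n a b => [|n IH] a b /=; first by rewrite midC -mulrN opprB.
by rewrite (IH (mid b a) b) (IH a (mid b a)) !(midC b) opprD addrC.
Qed.

Lemma msumB f g n a b :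
  msum (fun u => f u - g u) n a b = msum f n a b - msum g n a b.
Proof.
elim: n a b => [|n IH] a b /=; first by rewrite mulrBl.
by rewrite !IH opprD addrACA.
Qed.

(** The midpoint rule is exact on affine functions, so the first-order approximation of a function
    can be subtracted without error, whatever [n]. *)
Lemma msum_affine (k l : C) n a b :
  msum (fun u => k + l * u) n a b = (k + l * mid a b) * (b - a).
Proof. by elim: n a b => [|n IH] a b //=; rewrite !IH /mid; field. Qed.

Lemma msum_bound f K (e : R) n a b : midconvex K -> K a -> K b ->
  (forall u, K u -> nm (f u) <= e) -> nm (msum f n a b) <= e * nm (b - a).
Proof.
move=> mK Ka Kb H; elim: n a b Ka Kb => [|n IH] a b Ka Kb /=.
  by rewrite nmM; apply: ler_wpM2r => //; exact/H/mK.
have Km := mK _ _ Ka Kb.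
rewrite (le_trans (nmD _ _)) // (le_trans (lerD (IH _ _ Ka Km) (IH _ _ Km Kb))) //.
by rewrite nm_midl nm_midr -mulrDr -splitr.
Qed.

Lemma ball_midconvex z (r : R) : midconvex (fun u => nm (u - z) <= r).
Proof.
move=> a b Ha Hb; have -> : mid a b - z = (a - z) / 2 + (b - z) / 2.
  by rewrite /mid; field.
by rewrite (le_trans (nmD _ _)) // !nmM nm_half; lra.
Qed.

Definition ccont f z := forall e : R, 0 < e -> exists2 d : R, 0 < d &
  forall h, nm h < d -> nm (f (z + h) - f z) <= e.

(** A bound proportional to [|b - a|] passes from two halves to the whole; on a short segment near
    [z], continuity puts every sum within [e / 2 * |b - a|] of [f z * (b - a)]. *)
Lemma msum_cauchy f K (e : R) : nm_closed K -> midconvex K ->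
  (forall z, K z -> ccont f z) -> 0 < e ->
  forall a b, K a -> K b -> exists N, forall p q, (N <= p)%N -> (N <= q)%N ->
    nm (msum f p a b - msum f q a b) <= e * nm (b - a).
Proof.
move=> cK mK cf e0.
pose P (t : C * C) := K t.1 -> K t.2 -> exists N, forall p q, (N <= p)%N -> (N <= q)%N ->
    nm (msum f p t.1 t.2 - msum f q t.1 t.2) <= e * nm (t.2 - t.1).
suff H : forall t, P t by move=> a b; exact: (H (a, b)).
pose child (t t' : C * C) :=
  t' = (t.1, mid t.1 t.2) \/ t' = (mid t.1 t.2, t.2).
apply: (@cousin _ fst (fun t => nm (t.2 - t.1)) child K P cK) => //.
- by move=> [a b] /= nP; apply: contrapT => nK; apply: nP => /=.
- move=> [a b] t' [] -> /=; rewrite ?subrr ?nm0 ?nm_midl ?nm_midr; split=> //.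
  by rewrite ler_pdivrMr // ler_peMr // ler1n.
- move=> [a b] nP; apply: contrapT => H; apply: nP => /= Ka Kb.
  have Km := mK _ _ Ka Kb.
  have [N1 H1] : exists N, forall p q, (N <= p)%N -> (N <= q)%N ->
    nm (msum f p a (mid a b) - msum f q a (mid a b)) <= e * nm (mid a b - a).
    apply: contrapT => h; apply: H; exists (a, mid a b); first by left.
    by move=> hP; apply: h; exact: hP.
  have [N2 H2] : exists N, forall p q, (N <= p)%N -> (N <= q)%N ->
    nm (msum f p (mid a b) b - msum f q (mid a b) b) <= e * nm (b - mid a b).
    apply: contrapT => h; apply: H; exists (mid a b, b); first by right.
    by move=> hP; apply: h; exact: hP.
  exists (maxn N1 N2).+1 => -[//|p] [//|q]; rewrite !ltnS !geq_max.
  move=> /andP[p1 p2] /andP[q1 q2] /=; rewrite opprD addrACA (le_trans (nmD _ _)) //.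
  rewrite (le_trans (lerD (H1 _ _ p1 q1) (H2 _ _ p2 q2))) // nm_midl nm_midr.
  by rewrite -mulrDr -splitr.
- move=> z Kz; have e20 : 0 < e / 2 by rewrite divr_gt0.
  have [d d0 Hd] := cf _ Kz _ e20.
  (* The end [a] is within twice the length of [z], so the segment is within three times the
     length. *)
  exists (d / 4); first by rewrite divr_gt0.
  move=> [a b] /= az sd Ka Kb; exists 0%N => p q _ _.
  have B n : nm (msum f n a b - f z * (b - a)) <= e / 2 * nm (b - a).
    have -> : f z * (b - a) = msum (fun u => f z + 0 * u) n a b.
      by rewrite msum_affine mul0r addr0.
    rewrite -msumB; apply: (msum_bound _ (@ball_midconvex z (3 * nm (b - a)))).
    + by have := nm_ge0 (b - a); lra.
    + by have := nmBD a b z; lra.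
    + move=> u uz; rewrite mul0r addr0; have -> : u = z + (u - z) by rewrite addrC subrK.
      by apply: Hd; lra.
  rewrite (le_trans (nmBD (f z * (b - a)) _ _)) // (nm_subC (f z * _)).
  by have := B p; have := B q; lra.
Qed.

Definition cint f a b : C := lim ((fun n => msum f n a b) @ \oo).

Lemma cint_cvg f K a b : nm_closed K -> midconvex K ->
  (forall z, K z -> ccont f z) -> K a -> K b ->
  (fun n => msum f n a b) @ \oo --> cint f a b.
Proof.
move=> cK mK cf Ka Kb; suff [l Hl] : exists l : C, (fun n => msum f n a b) @ \oo --> l.
  by rewrite /cint (cvg_lim _ Hl).
apply: cauchyC => e e0.
have e'0 : 0 < e / (1 + nm (b - a)) by rewrite divr_gt0 // ltr_pwDl.
have [N HN] := msum_cauchy cK mK cf e'0 Ka Kb; exists N => p q hp hq.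
rewrite (le_trans (HN _ _ hp hq)) // mulrAC ler_pdivrMr ?ltr_pwDl //.
by rewrite ler_wpM2l ?ltW // ltrDr.
Qed.

Section OnK.
Variables (f : C -> C) (K : C -> Prop).
Hypotheses (cK : nm_closed K) (mK : midconvex K) (cf : forall z, K z -> ccont f z).

Lemma cint_rev a b : K a -> K b -> cint f b a = - cint f a b.
Proof.
move=> Ka Kb; rewrite {1}/cint; apply: cvg_lim => //.
under eq_fun do rewrite msum_rev; apply: cvgN; exact: (cint_cvg cK mK cf Ka Kb).
Qed.

Lemma cint_mid a b : K a -> K b ->
  cint f a b = cint f a (mid a b) + cint f (mid a b) b.
Proof.
move=> Ka Kb; have Km := mK Ka Kb.
rewrite {1}/cint; apply: cvg_lim => //; rewrite -(cvg_shiftS _ _) /=.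
exact: cvgD (cint_cvg cK mK cf Ka Km) (cint_cvg cK mK cf Km Kb).
Qed.

(** [K] carries the convergence of the sums, [L] the estimate: in the uses, [L] is a small ball on
    which [f] is nearly affine. *)
Lemma cint_bound a b L (k l : C) (e : R) : K a -> K b -> midconvex L -> L a -> L b ->
  (forall u, L u -> nm (f u - (k + l * u)) <= e) ->
  nm (cint f a b - (k + l * mid a b) * (b - a)) <= e * nm (b - a).
Proof.
move=> Ka Kb mL La Lb H; apply: (lim_nm_le (cint_cvg cK mK cf Ka Kb)) => n.
by rewrite -(msum_affine k l n) -msumB; exact: msum_bound H.
Qed.

Definition tint a b c := cint f a b + cint f b c + cint f c a.

(** Medial subdivision: each edge of the inner triangle is traversed twice, in opposite
    directions. *)
Lemma tint_split a b c : K a -> K b -> K c ->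
  tint a b c = tint a (mid a b) (mid c a) + tint (mid a b) b (mid b c)
    + tint (mid c a) (mid b c) c + tint (mid b c) (mid c a) (mid a b).
Proof.
move=> Ka Kb Kc; have Kab := mK Ka Kb; have Kbc := mK Kb Kc; have Kca := mK Kc Ka.
rewrite /tint (cint_mid Ka Kb) (cint_mid Kb Kc) (cint_mid Kc Ka).
rewrite (cint_rev Kab Kca) (cint_rev Kbc Kab) (cint_rev Kbc Kca).
ring.
Qed.

Hypothesis df : forall z, K z -> exists l, cder f z l.

(** The square of the perimeter makes bisection lossless: four pieces of half the perimeter
    contribute [4 * (s / 2)^2 = s^2]. On a small triangle the affine part of [f] integrates to [0]
    and only its first-order remainder is left. *)
Lemma goursat_le (e : R) a b c : 0 < e -> K a -> K b -> K c ->
  nm (tint a b c) <= e * (nm (b - a) + nm (c - b) + nm (a - c)) ^+ 2.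
Proof.
move=> e0.
pose size (t : C * C * C) := nm (t.1.2 - t.1.1) + nm (t.2 - t.1.2) + nm (t.1.1 - t.2).
pose P (t : C * C * C) := K t.1.1 -> K t.1.2 -> K t.2 ->
  nm (tint t.1.1 t.1.2 t.2) <= e * (size t) ^+ 2.
suff H : forall t, P t by exact: (H (a, b, c)).
pose child (t t' : C * C * C) :=
  [\/ t' = (t.1.1, mid t.1.1 t.1.2, mid t.2 t.1.1),
      t' = (mid t.1.1 t.1.2, t.1.2, mid t.1.2 t.2),
      t' = (mid t.2 t.1.1, mid t.1.2 t.2, t.2) |
      t' = (mid t.1.2 t.2, mid t.2 t.1.1, mid t.1.1 t.1.2)].
have sz t t' : child t t' -> size t' = size t / 2.
  case: t => [[x y] w] ht.
  have hd (u v : C) (r : C) : u - v = r / 2 -> nm (u - v) = nm r / 2.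
    by move=> ->; rewrite nmM nm_half.
  rewrite /size; case: ht => -> /=.
  - rewrite (hd (mid x y) x (y - x)) ?(hd (mid w x) _ (w - y))
      ?(hd x (mid w x) (x - w)) /mid; by field.
  - rewrite (hd y (mid x y) (y - x)) ?(hd (mid y w) y (w - y))
      ?(hd (mid x y) (mid y w) (x - w)) /mid; by field.
  - rewrite (hd (mid y w) (mid w x) (y - x)) ?(hd w (mid y w) (w - y))
      ?(hd (mid w x) w (x - w)) /mid; by field.
  - rewrite (hd (mid w x) (mid y w) (x - y)) ?(hd (mid x y) (mid w x) (y - w))
      ?(hd (mid y w) (mid x y) (w - x)) /mid; [|by field..].
    by rewrite (nm_subC x y) (nm_subC y w) (nm_subC w x); field.
apply: (@cousin _ (fun t => t.1.1) size child K P cK).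
- by move=> [[a' b'] c'] nP; apply: contrapT => nK; apply: nP => /= /nK.
- by move=> t; rewrite /size !addr_ge0.
- move=> [[x y] w] t' ht; split; last exact: sz.
  have [p1 p2 p3] : [/\ 0 <= nm (y - x), 0 <= nm (w - y) & 0 <= nm (x - w)] by [].
  have hy := nm_midl x y.
  have hw : nm (mid w x - x) = nm (x - w) / 2 by rewrite nm_subC nm_midr.
  have hm : nm (mid y w - x) <= nm (y - x) / 2 + nm (x - w) / 2.
    have -> : mid y w - x = (y - x) / 2 - (x - w) / 2 by rewrite /mid; field.
    by rewrite (le_trans (nmB _ _)) // !nmM nm_half.
  by rewrite /size; case: ht => -> /=; rewrite ?subrr ?nm0; lra.
- move=> [[x y] w] nP; apply: contrapT => H; apply: nP => /= Kx Ky Kw.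
  have Kxy := mK Kx Ky; have Kyw := mK Ky Kw; have Kwx := mK Kw Kx.
  have HH x' y' w' : child (x, y, w) (x', y', w') -> K x' -> K y' -> K w' ->
    nm (tint x' y' w') <= e * (size (x, y, w) / 2) ^+ 2.
    move=> ct k1 k2 k3; rewrite -(sz _ _ ct); apply: contrapT => h; apply: H.
    by exists (x', y', w') => // hP; apply: h; exact: hP.
  rewrite tint_split //; apply: (le_trans (nmD _ _)).
  have c1 : child (x, y, w) (x, mid x y, mid w x) by constructor 1.
  have c2 : child (x, y, w) (mid x y, y, mid y w) by constructor 2.
  have c3 : child (x, y, w) (mid w x, mid y w, w) by constructor 3.
  have c4 : child (x, y, w) (mid y w, mid w x, mid x y) by constructor 4.
  have b1 := HH _ _ _ c1 Kx Kxy Kwx; have b2 := HH _ _ _ c2 Kxy Ky Kyw.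
  have b3 := HH _ _ _ c3 Kwx Kyw Kw; have b4 := HH _ _ _ c4 Kyw Kwx Kxy.
  have := nmD (tint x (mid x y) (mid w x) + tint (mid x y) y (mid y w))
    (tint (mid w x) (mid y w) w).
  have := nmD (tint x (mid x y) (mid w x)) (tint (mid x y) y (mid y w)).
  move: b1 b2 b3 b4; rewrite !exprMn exprVn.
  have -> : (2 ^+ 2 : R) = 4 by rewrite -natrX.
  lra.
- move=> z Kz; have [l Hl] := df Kz; have e30 : 0 < e / 3 by rewrite divr_gt0.
  have [d d0 Hd] := Hl _ e30.
  (* The vertices lie in the ball of radius [3 * s] about [z], where the affine error is at most
     [e / 3 * (3 * s)]. *)
  exists (d / 4); first by rewrite divr_gt0.
  move=> [[x y] w] /= xz sd Kx Ky Kw; set s := size _ in xz sd *.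
  have [p1 p2 p3] : [/\ 0 <= nm (y - x), 0 <= nm (w - y) & 0 <= nm (x - w)] by [].
  have sE : s = nm (y - x) + nm (w - y) + nm (x - w) by [].
  pose L u := nm (u - z) <= 3 * s.
  have mL : midconvex L by exact: ball_midconvex.
  have Lx : L x by rewrite /L; lra.
  have Ly : L y by rewrite /L; have := nmBD x y z; lra.
  have Lw : L w by rewrite /L; have := nmBD x w z; rewrite (nm_subC w x); lra.
  pose k := f z - l * z.
  have HL u : L u -> nm (f u - (k + l * u)) <= e * s.
    move=> Lu; have hu : u = z + (u - z) by rewrite addrC subrK.
    have := Hd (u - z); rewrite -hu => h.
    have -> : f u - (k + l * u) = f u - f z - l * (u - z) by rewrite /k; ring.
    have e3 : e / 3 * nm (u - z) <= e / 3 * (3 * s) by rewrite ler_wpM2l // ltW.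
    have := Lu; rewrite /L => Lu'; apply: (le_trans (h _)); first by lra.
    by rewrite (le_trans e3) //; lra.
  have B1 := cint_bound Kx Ky mL Lx Ly HL.
  have B2 := cint_bound Ky Kw mL Ly Lw HL.
  have B3 := cint_bound Kw Kx mL Lw Lx HL.
  have -> : tint x y w = (cint f x y - (k + l * mid x y) * (y - x))
     + (cint f y w - (k + l * mid y w) * (w - y))
     + (cint f w x - (k + l * mid w x) * (x - w)).
    by rewrite /tint /mid; field.
  rewrite (le_trans (nmD _ _)) // (le_trans (lerD (nmD _ _) (lexx _))) //.
  rewrite (le_trans (lerD (lerD B1 B2) B3)) // -!mulrDr -sE -mulrA expr2.
  exact: lexx.
Qed.

Lemma goursat a b c : K a -> K b -> K c -> tint a b c = 0.
Proof.
move=> Ka Kb Kc; apply/eqP; rewrite -nm_eq0 eq_le nm_ge0 andbT.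
apply/ler_addgt0Pr => e e0; rewrite add0r.
set s := (nm (b - a) + nm (c - b) + nm (a - c)) ^+ 2.
have s0 : 0 <= s by exact: sqr_ge0.
have e'0 : 0 < e / (1 + s) by rewrite divr_gt0 // ltr_pwDl.
rewrite (le_trans (goursat_le e'0 Ka Kb Kc)) // -/s mulrAC ler_pdivrMr ?ltr_pwDl //.
by rewrite ler_wpM2l ?ltW // ltrDr.
Qed.

End OnK.

Definition opn (D : C -> Prop) := forall z, D z -> exists2 d : R, 0 < d &
  forall h, nm h < d -> D (z + h).

(** The limit of a bisection could leave an open set. A closed midpoint-convex set containing three
    given points keeps their triangle and all its limit points inside [D]. *)
Definition cvx_exhausted (D : C -> Prop) := forall a b c, D a -> D b -> D c ->
  exists K, [/\ nm_closed K, midconvex K, (forall z, K z -> D z) & [/\ K a, K b & K c]].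

(** Integrate from a base point [z0]. Goursat on the triangle [z0], [z], [z + h] turns the increment
    into the integral over a short segment, which is compared with the constant [f z]. *)
Theorem primitive (D : C -> Prop) f : opn D -> cvx_exhausted D ->
  (forall z, D z -> exists l, cder f z l) ->
  exists F, forall z, D z -> cder F z (f z).
Proof.
move=> oD eD df.
have cf z : D z -> ccont f z by move=> /df[l Hl]; exact: cder_cont Hl.
have [[z0 Dz0]|nD] := pselect (exists z, D z); last first.
  by exists f => z Dz; exfalso; apply: nD; exists z.
exists (cint f z0) => z Dz e e0.
have [d1 d10 H1] := oD z Dz; have [d2 d20 H2] := cf z Dz _ e0.
exists (Num.min d1 d2); first by rewrite lt_min d10.
move=> h; rewrite lt_min => /andP[h1 h2].
have [K [cK mK KD [K0 Kz Kh]]] := eD _ _ _ Dz0 Dz (H1 h h1).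
have cfK u : K u -> ccont f u by move=> /KD; exact: cf.
have dfK u : K u -> exists l, cder f u l by move=> /KD; exact: df.
have := goursat cK mK cfK dfK K0 Kz Kh; rewrite /tint (cint_rev cK mK cfK K0 Kh).
move=> /eqP; rewrite subr_eq0 => /eqP <-; rewrite (addrC (cint f z0 z)) addrK.
have mL := @ball_midconvex z (nm h).
have := @cint_bound f K cK mK cfK z (z + h) _ (f z) 0 e Kz Kh mL.
rewrite mul0r addr0 (addrC z h) addrK; apply=> //.
- by rewrite subrr nm0.
- move=> u uh; rewrite mul0r addr0; have -> : u = z + (u - z) by rewrite addrC subrK.
  by apply: H2; exact: le_lt_trans uh h2.
Qed.

End Goursat.

(** * Mean value inequalities along segments, and the convex domains that admit primitives *)

Section MeanValue.
Context {R : realType}.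
Local Notation C := (Cpx R).
Implicit Types (f g F : C -> C) (a b c z : C).

Lemma rderP (f : R -> R) (t l : R) :
  (forall e : R, 0 < e -> exists2 d : R, 0 < d &
    forall h, `|h| < d -> `|f (t + h) - f t - l * h| <= e * `|h|)
  <-> is_derive t 1 f l.
Proof.
have qE h : h != 0 :> R ->
  l - h^-1 *: ((f \o shift t) (h *: 1) - f t) = - (h^-1 * (f (t + h) - f t - l * h)).
  move=> h0 /=; rewrite [h *: 1]mulr1 [_ *: _]/(_ * _) (addrC h) mulrBr.
  by rewrite (mulrC l) mulKf // opprB.
set A := (X in X <-> _).
suff E : A <-> (fun h => h^-1 *: ((f \o shift t) (h *: 1) - f t)) @ 0^' --> l.
  rewrite E; split=> [H|[H1 H2]]; last by rewrite -H2.
  by split; [apply/cvg_ex; exists l | exact: cvg_lim H].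
rewrite cvgrPdist_le; split=> H e e0.
  have [d d0 Hd] := H e e0.
  rewrite near_withinE; apply/nbhs_ballP; exists d => //= h; rewrite /ball /= sub0r normrN => hd h0.
  rewrite qE // normrN normrM normfV ler_pdivrMl ?normr_gt0 // [`|h| * e]mulrC; exact: Hd.
have := H e e0; rewrite near_withinE => /nbhs_ballP[d d0 Hd].
exists d => // h hd; have [->|h0] := eqVneq h 0.
  by rewrite addr0 subrr sub0r mulr0 oppr0 normr0 mulr0.
have := Hd h; rewrite /ball /= sub0r normrN => /(_ hd h0).
rewrite qE // normrN normrM normfV.
by rewrite ler_pdivrMl ?normr_gt0 // [`|h| * e]mulrC.
Qed.

Lemma Re_is_derive F a d l (t : R) : cder F (a + RtoC t * d) l ->
  is_derive t 1 (fun t => complex.Re (F (a + RtoC t * d))) (complex.Re (l * d)).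
Proof.
move=> HF; apply/rderP => e e0.
have D0 : 0 < nm d + 1 by rewrite ltr_wpDl.
have e'0 : 0 < e / (nm d + 1) by rewrite divr_gt0.
have [r r0 Hr] := HF _ e'0; exists (r / (nm d + 1)); first by rewrite divr_gt0.
move=> h; rewrite ltr_pdivlMr // => hr.
have nh : nm (RtoC h * d) <= `|h| * (nm d + 1).
  by rewrite nmM nm_RtoC ler_wpM2l // lerDl.
have := Hr (RtoC h * d) (le_lt_trans nh hr).
have -> : a + RtoC t * d + RtoC h * d = a + RtoC (t + h) * d.
  by rewrite RtoCD mulrDl addrA.
move=> H.
have -> : complex.Re (F (a + RtoC (t + h) * d)) - complex.Re (F (a + RtoC t * d))
    - complex.Re (l * d) * h =
  complex.Re (F (a + RtoC (t + h) * d) - F (a + RtoC t * d) - l * (RtoC h * d)).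
  by rewrite !(cReD, cReN) mulrCA cReMl (mulrC h).
rewrite (le_trans (Re_le_nm _)) // (le_trans H) //.
rewrite (le_trans (ler_wpM2l (ltW e'0) nh)) // mulrA mulrAC divfK ?gt_eqF //.
Qed.

(** The mean value theorem has no complex-valued form, so it is applied to the real part along the
    segment; rotations then recover the modulus. *)
Lemma Re_mvt F f a b (M : R) :
  (forall t : R, 0 <= t <= 1 -> cder F (a + RtoC t * (b - a)) (f (a + RtoC t * (b - a)))) ->
  (forall t : R, 0 <= t <= 1 -> complex.Re (f (a + RtoC t * (b - a)) * (b - a)) <= M) ->
  complex.Re (F b - F a) <= M.
Proof.
move=> HF HM.
pose phi (t : R) := complex.Re (F (a + RtoC t * (b - a))).
pose dphi (t : R) := complex.Re (f (a + RtoC t * (b - a)) * (b - a)).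
have dp (t : R) : t \in `[0, 1]%R -> is_derive t 1 phi (dphi t).
  by rewrite in_itv /= => ht; apply: Re_is_derive; exact: HF.
have H01 : (0 : R) <= 1 by exact: ler01.
have Hd (t : R) : t \in `]0, 1[%R -> is_derive t 1 phi (dphi t).
  rewrite in_itv /= => /andP[t0 t1]; apply: dp.
  by rewrite in_itv /= !ltW.
have Hc : {within `[0, 1], continuous phi}.
  apply: derivable_within_continuous => t ht; have [H _] := dp _ ht; exact: H.
have [c + E] := MVT_segment H01 Hd Hc.
rewrite in_itv /= => hc; move: E; rewrite /phi subr0 mulr1 RtoC1 RtoC0 mul0r mul1r addr0.
by rewrite (addrC a) subrK cReD cReN => ->; exact: HM.
Qed.

Lemma nm_mvt F f a b (M : R) :
  (forall t : R, 0 <= t <= 1 -> cder F (a + RtoC t * (b - a)) (f (a + RtoC t * (b - a)))) ->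
  (forall t : R, 0 <= t <= 1 -> nm (f (a + RtoC t * (b - a))) <= M) ->
  nm (F b - F a) <= M * nm (b - a).
Proof.
move=> HF HM; apply: nm_le_rot => u u1; rewrite mulrBr.
apply: (@Re_mvt (fun z => u * F z) (fun z => u * f z)) => t ht.
  by apply: cderZ; exact: HF.
rewrite (le_trans (ler_norm _)) // (le_trans (Re_le_nm _)) // !nmM u1 mul1r.
by rewrite ler_wpM2r // HM.
Qed.

Lemma seg_convex (r : R) c a b (t : R) : nm (a - c) < r -> nm (b - c) < r -> 0 <= t <= 1 ->
  nm (a + RtoC t * (b - a) - c) < r.
Proof.
move=> Ha Hb /andP[t0 t1].
have -> : a + RtoC t * (b - a) - c = RtoC (1 - t) * (a - c) + RtoC t * (b - c).
  by rewrite RtoCB RtoC1; ring.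
rewrite (le_lt_trans (nmD _ _)) // !nmM !nm_RtoC !ger0_norm ?subr_ge0 //.
have [t00|tn0] := eqVneq t 0; first by rewrite t00 subr0 mul1r mul0r addr0.
have tp : 0 < t by rewrite lt_neqAle eq_sym tn0.
have h1 : t * nm (b - c) < t * r by rewrite ltr_pM2l.
have h2 : (1 - t) * nm (a - c) <= (1 - t) * r by rewrite ler_wpM2l ?subr_ge0 // ltW.
lra.
Qed.

Lemma disk_opn c (r : R) : opn (fun z : C => nm (z - c) < r).
Proof.
move=> z hz; exists (r - nm (z - c)); first by rewrite subr_gt0.
by move=> h hh; rewrite addrAC (le_lt_trans (nmD _ _)) //; lra.
Qed.

Lemma cball_nm_closed c (r : R) : nm_closed (fun z : C => nm (z - c) <= r).
Proof.
move=> z H; apply/ler_addgt0Pr => e e0; have [w hw wz] := H e e0.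
by rewrite (le_trans (nmBD w _ _)) // (nm_subC z); lra.
Qed.

Lemma disk_exhausted c (r : R) : cvx_exhausted (fun z : C => nm (z - c) < r).
Proof.
move=> x y w hx hy hw.
pose s := Num.max (nm (x - c)) (Num.max (nm (y - c)) (nm (w - c))).
exists (fun z => nm (z - c) <= s); split.
- exact: cball_nm_closed.
- exact: ball_midconvex.
- by move=> z hz; rewrite (le_lt_trans hz) // /s !gt_max hx hy.
- by rewrite /s !le_max !lexx !orbT.
Qed.

(** [cexp] maps this half-plane onto the punctured unit disk, vertical segments of length [2 * pi]
    covering circles. Being convex, it carries primitives that need not exist on the punctured
    disk. *)
Definition lhp (z : C) := complex.Re z < 0.

Lemma lhp_opn : opn lhp.
Proof.
move=> z hz; exists (- complex.Re z); first by rewrite oppr_gt0.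
move=> h hh; rewrite /lhp cReD; have := le_trans (ler_norm _) (Re_le_nm h); lra.
Qed.

Lemma lhp_exhausted : cvx_exhausted lhp.
Proof.
rewrite /lhp => x y w hx hy hw.
pose s := Num.max (complex.Re x) (Num.max (complex.Re y) (complex.Re w)).
exists (fun z => complex.Re z <= s); split.
- move=> z H; apply/ler_addgt0Pr => e e0; have [v hv vz] := H e e0.
  have := le_trans (ler_norm _) (Re_le_nm (z - v)).
  by rewrite nm_subC cReD cReN; lra.
- move=> a b ha hb; rewrite /mid mulrC -RtoC_nat -RtoCV cReMl cReD; lra.
- by move=> z hz; rewrite (le_lt_trans hz) // /s !gt_max hx hy.
- by rewrite /s !le_max !lexx !orbT.
Qed.

End MeanValue.

(** * The complex exponential and its derivative *)

Section ComplexExp.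
Context {R : realType}.
Local Notation C := (Cpx R).

Definition cexp (z : C) : C :=
  RtoC (expR (complex.Re z)) * (RtoC (cos (complex.Im z)) + 'i * RtoC (sin (complex.Im z))).

Lemma Re_cexp z : complex.Re (cexp z) = expR (complex.Re z) * cos (complex.Im z).
Proof. by rewrite cReMl cReD cReM cRe_i cIm_i /=; ring. Qed.

Lemma Im_cexp z : complex.Im (cexp z) = expR (complex.Re z) * sin (complex.Im z).
Proof. by rewrite cImMl cImD cImM cRe_i cIm_i /=; ring. Qed.

Lemma cexpD z w : cexp (z + w) = cexp z * cexp w.
Proof.
apply: C_eq.
  by rewrite Re_cexp (cReM (cexp z)) !Re_cexp !Im_cexp !(cReD, cImD) expRD cosD; ring.
by rewrite Im_cexp (cImM (cexp z)) !Re_cexp !Im_cexp !(cReD, cImD) expRD sinD; ring.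
Qed.

Lemma nm_cexp z : nm (cexp z) = expR (complex.Re z).
Proof.
apply/eqP; rewrite -(@eqrXn2 _ 2) // ?nm_ge0 ?expR_ge0 // nm_sqr Re_cexp Im_cexp.
by rewrite !exprMn -mulrDr cos2Dsin2 mulr1.
Qed.

Lemma cexp_neq0 z : cexp z != 0.
Proof. by rewrite -nm_gt0 nm_cexp expR_gt0. Qed.

Lemma cexp0 : cexp 0 = 1.
Proof. by apply: C_eq; rewrite ?Re_cexp ?Im_cexp /= expR0 ?cos0 ?sin0 mul1r. Qed.

Lemma cexpN z : cexp (- z) = (cexp z)^-1.
Proof.
apply: (mulfI (cexp_neq0 z)); rewrite -cexpD subrr cexp0 divff //; exact: cexp_neq0.
Qed.

Definition twopii : C := 'i * RtoC (2 * pi).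

Lemma cexp_period z : cexp (z + twopii) = cexp z.
Proof.
have cpi : cos (2 * pi : R) = 1 by rewrite mulr_natl cos2pi.
have spi : sin (2 * pi : R) = 0 by rewrite mulr_natl sin2pi.
rewrite cexpD; have -> : cexp twopii = 1; last by rewrite mulr1.
by apply: C_eq; rewrite ?Re_cexp ?Im_cexp cReM cImM cRe_i cIm_i /=
  !(mul0r, mul1r, mulr0, addr0, subr0, add0r) ?cpi ?spi expR0 mul1r.
Qed.

Lemma cexp_der0 : cder cexp 0 1.
Proof.
move=> e e0.
(* [8 = 1 + 2 + 3 + 2], the coefficients of [e' * nm h] in the bounds [a1] to [a4] below; [e' <= 1]
   keeps [expR x] below [3]. *)
pose e' := Num.min 1 (e / 8).
have e'0 : 0 < e' by rewrite lt_min ltr01 divr_gt0.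
have e'1 : e' <= 1 by rewrite ge_min lexx.
have e'e : e' <= e / 8 by rewrite ge_min lexx orbT.
have /rderP /(_ _ e'0) [d1 d10 H1] : is_derive (0 : R) 1 expR (expR 0) by exact: is_derive_expR.
have /rderP /(_ _ e'0) [d2 d20 H2] : is_derive (0 : R) 1 cos (- sin 0) by exact: is_derive_cos.
have /rderP /(_ _ e'0) [d3 d30 H3] : is_derive (0 : R) 1 sin (cos 0) by exact: is_derive_sin.
exists (Num.min e' (Num.min d1 (Num.min d2 d3))).
  by rewrite lt_min e'0 lt_min d10 lt_min d20 d30.
move=> h; rewrite lt_min => /andP[h0]; rewrite lt_min => /andP[h1].
rewrite lt_min => /andP[h2 h3].
rewrite add0r cexp0 mul1r.
set x := complex.Re h; set y := complex.Im h.
have xh : `|x| <= nm h by exact: Re_le_nm.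
have yh : `|y| <= nm h by exact: Im_le_nm.
have := H1 x (le_lt_trans xh h1); rewrite add0r expR0 mul1r => X1.
have := H2 y (le_lt_trans yh h2); rewrite add0r cos0 sin0 oppr0 mul0r subr0 => Y2.
have := H3 y (le_lt_trans yh h3); rewrite add0r cos0 sin0 mul1r subr0 => Y3.
have cy : `|cos y| <= 1 by exact: cos_max.
have x1 : `|x| <= e' by rewrite (le_trans xh) // ltW.
have ex : `|expR x - 1| <= 2 * `|x|.
  have -> : expR x - 1 = (expR x - 1 - x) + x by ring.
  rewrite (le_trans (ler_normD _ _)) //.
  have : e' * `|x| <= 1 * `|x| by rewrite ler_wpM2r.
  lra.
have ex3 : `|expR x| <= 3.
  have -> : expR x = (expR x - 1) + 1 by ring.
  rewrite (le_trans (ler_normD _ _)) // normr1; lra.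
apply: (le_trans (nm_le_ReIm _)).
rewrite !(cReD, cReN, cImD, cImN) Re_cexp Im_cexp -/x -/y /=.
have -> : expR x * cos y - 1 - x = (expR x - 1 - x) * cos y + (1 + x) * (cos y - 1) by ring.
have -> : expR x * sin y - 0 - y = expR x * (sin y - y) + (expR x - 1) * y by ring.
have a1 : `|(expR x - 1 - x) * cos y| <= e' * nm h.
  rewrite normrM -[leRHS]mulr1 ler_pM // (le_trans X1) // ler_wpM2l // ltW //.
have a2 : `|(1 + x) * (cos y - 1)| <= 2 * (e' * nm h).
  rewrite normrM ler_pM //.
    by rewrite (le_trans (ler_normD _ _)) // normr1; lra.
  by rewrite (le_trans Y2) // ler_wpM2l // ltW.
have a3 : `|expR x * (sin y - y)| <= 3 * (e' * nm h).
  rewrite normrM ler_pM //.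
  by rewrite (le_trans Y3) // ler_wpM2l // ltW.
have a4 : `|(expR x - 1) * y| <= 2 * (e' * nm h).
  rewrite normrM mulrA ler_pM // (le_trans ex) //; lra.
have := ler_normD ((expR x - 1 - x) * cos y) ((1 + x) * (cos y - 1)).
have := ler_normD (expR x * (sin y - y)) ((expR x - 1) * y).
have : e' * nm h <= e / 8 * nm h by rewrite ler_wpM2r.
lra.
Qed.

Lemma cder_cexp z : cder cexp z (cexp z).
Proof.
move=> e e0; have p0 : 0 < nm (cexp z) by rewrite nm_gt0 cexp_neq0.
have e'0 : 0 < e / nm (cexp z) by rewrite divr_gt0.
have [d d0 Hd] := cexp_der0 e'0; exists d => // h /Hd.
rewrite add0r cexp0 mul1r => H.
have -> : cexp (z + h) - cexp z - cexp z * h = cexp z * (cexp h - 1 - h).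
  by rewrite cexpD; ring.
rewrite nmM -ler_pdivlMl // mulrA (mulrC _^-1) //.
Qed.

End ComplexExp.

(** * Mean values on circles, Cauchy's estimate and differentiability of derivatives *)

Section MeanProperty.
Context {R : realType}.
Local Notation C := (Cpx R).
Implicit Types (f g F : C -> C) (a b c z k w : C).

Definition lim0 f (l : C) := forall e : R, 0 < e -> exists2 d : R, 0 < d &
  forall z, z != 0 -> nm z < d -> nm (f z - l) <= e.

Lemma lhp_seg a b (t : R) : lhp a -> lhp b -> 0 <= t <= 1 -> lhp (a + RtoC t * (b - a)).
Proof.
rewrite /lhp => Ha Hb /andP[t0 t1]; rewrite cReD cReMl cReD cReN.
have [->|tn1] := eqVneq t 1; first by rewrite mul1r addrC subrK.
have tp : 0 < 1 - t by rewrite subr_gt0 lt_neqAle tn1.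
have h1 : (1 - t) * complex.Re a < 0 by rewrite pmulr_rlt0.
have h2 : t * complex.Re b <= 0 by rewrite mulr_ge0_le0 // ltW.
lra.
Qed.

Lemma nm_twopii : nm (@twopii R) = 2 * pi.
Proof. by rewrite nmM nm_i mul1r nm_RtoC ger0_norm // mulr_ge0 // pi_ge0. Qed.

Lemma Re_twopii (s : C) : complex.Re (s + twopii) = complex.Re s.
Proof. by rewrite cReD cReM cRe_i cIm_i /=; ring. Qed.

(* Primitives [H] of [k1 (exp s)] on the left half-plane play the role of contour
   integrals: the increment of [H] over a period is the integral of [k1 z / z]
   along a circle, and it is constant because its derivative vanishes. *)
Lemma period_increment (k1 H : C -> C) (l s : C) :
  lim0 k1 l -> (forall s, lhp s -> cder H s (k1 (cexp s))) -> lhp s ->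
  H (s + twopii) - H s = l * twopii.
Proof.
move=> Hl HH hs.
have lp (s' : C) : lhp s' -> lhp (s' + twopii) by move=> h; rewrite /lhp Re_twopii.
have dP (s' : C) : lhp s' -> cder (fun s => H (s + twopii) - H s) s' 0.
  move=> h; rewrite -(subrr (k1 (cexp s'))); apply: cderB; last exact: HH.
  have D : cder (fun s : C => s + twopii) s' 1.
    by rewrite -[1]addr0; exact: cderD (cder_id _) (cder_cst _ _).
  have := cder_comp D (HH _ (lp _ h)).
  by rewrite cexp_period mulr1.
have cst (s1 s2 : C) : lhp s1 -> lhp s2 ->
    H (s1 + twopii) - H s1 = H (s2 + twopii) - H s2.
  move=> h1 h2; apply/eqP; rewrite -subr_eq0 -nm_eq0 eq_le nm_ge0 andbT.
  have := @nm_mvt R (fun s => H (s + twopii) - H s) (fun=> 0) s2 s1 0.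
  rewrite mul0r; apply=> t ht; last by rewrite nm0.
  by apply: dP; exact: lhp_seg.
apply/eqP; rewrite -subr_eq0 -nm_eq0 eq_le nm_ge0 andbT.
apply/ler_addgt0Pr => e e0; rewrite add0r.
have p0 : 0 < 2 * pi :> R by rewrite mulr_gt0 // pi_gt0.
have e'0 : 0 < e / (2 * pi) by rewrite divr_gt0.
have [d d0 Hd] := Hl _ e'0.
(* Far enough to the left for [cexp] to be within [d] of [0] on the whole vertical segment, where
   the derivative of [H s - l * s] is at most [e / (2 * pi)] in modulus. *)
pose x := Num.min (-1) (ln (d / 2)).
have d20 : 0 < d / 2 by rewrite divr_gt0.
have hx : lhp (RtoC x).
  by rewrite /lhp /= /x gt_min; apply/orP; left; rewrite oppr_lt0.
have ex : expR x < d.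
  have : expR x <= d / 2.
    by rewrite -[leRHS]lnK ?posrE // ler_expR /x ge_min lexx orbT.
  by have := d0; lra.
rewrite (cst _ _ hs hx).
have -> : H (RtoC x + twopii) - H (RtoC x) - l * twopii =
  (H (RtoC x + twopii) - l * (RtoC x + twopii)) - (H (RtoC x) - l * RtoC x) by ring.
have := @nm_mvt R (fun s => H s - l * s) (fun s => k1 (cexp s) - l)
  (RtoC x) (RtoC x + twopii) (e / (2 * pi)).
rewrite (addrC (RtoC x)) addrK nm_twopii divfK ?gt_eqF //; apply=> t ht.
  apply: cderB.
    by apply: HH; rewrite /lhp cReD cReMl cReM cRe_i cIm_i /= !(mul0r, mulr0, subr0, addr0).
  by rewrite -[l in cder _ _ l]mulr1; apply: cderZ; exact: cder_id.
apply: Hd; first exact: cexp_neq0.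
by rewrite nm_cexp cReD cReMl cReM cRe_i cIm_i /= !(mul0r, mulr0, subr0, addr0).
Qed.

(** The average of [k] over the circle of radius [r] is its constant Laurent term [l], because the
    polar terms, pulled back by [exp], have the periodic primitives [- c exp(-s)] and
    [- (d / 2) exp(-2 s)]. A double pole is allowed because the test polynomial used for the
    coefficient inequality has degree two. *)
Lemma mean_Re_ge0 (k : C -> C) c (d l : C) (r : R) : 0 < r < 1 ->
  (forall z, z != 0 -> nm z < 1 -> exists l, cder k z l) ->
  lim0 (fun z => k z - c / z - d / z ^+ 2) l ->
  (forall z, nm z = r -> 0 <= complex.Re (k z)) -> 0 <= complex.Re l.
Proof.
move=> /andP[r0 r1] dk Hl Hr.
pose k1 (z : C) := k z - c / z - d / z ^+ 2.
have dk1 (z : C) : z != 0 -> nm z < 1 -> exists l, cder k1 z l.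
  move=> z0 z1; have [m Hm] := dk _ z0 z1.
  exists (m - c * (- (z ^+ 2)^-1) - d * (- (1 * z + z * 1) / (z ^+ 2) ^+ 2)).
  apply: cderB; [apply: cderB => //|]; apply: cderZ; first exact: cder_inv.
  by apply: (@cderV _ (fun z => z ^+ 2)); [rewrite expf_neq0|exact: cderM (cder_id _) (cder_id _)].
have nl (s : C) : lhp s -> nm (cexp s) < 1.
  by rewrite /lhp nm_cexp -expR0 ltr_expR.
have [H HH] : exists H, forall s : C, lhp s -> cder H s (k1 (cexp s)).
  apply: primitive; [exact: lhp_opn|exact: lhp_exhausted|] => s hs.
  have [m Hm] := dk1 _ (cexp_neq0 s) (nl _ hs).
  by exists (m * cexp s); exact: cder_comp (cder_cexp s) Hm.
pose s0 : C := RtoC (ln r).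
have hs0 : lhp s0 by rewrite /lhp /= ln_lt0 // r0.
have HP := period_increment Hl HH hs0.
pose G s := H s - c * cexp (- s) - d / 2 * cexp (- (s + s)).
have dG (s : C) : lhp s -> cder G s (k (cexp s)).
  move=> hs.
  have D1 : cder (fun s => cexp (- s)) s (cexp (- s) * -1).
    by apply: cder_comp (cder_cexp _); apply: cderN; exact: cder_id.
  have D2 : cder (fun s => cexp (- (s + s))) s (cexp (- (s + s)) * - (1 + 1)).
    by apply: cder_comp (cder_cexp _); apply: cderN; exact: cderD (cder_id _) (cder_id _).
  have := cderB (cderB (HH _ hs) (cderZ c D1)) (cderZ (d / 2) D2).
  rewrite !cexpN cexpD /k1; congr (cder _ _ _).
  by field; exact: cexp_neq0.
have HG : G (s0 + twopii) - G s0 = l * twopii.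
  rewrite -HP /G; have -> : - (s0 + twopii + (s0 + twopii)) = - (s0 + s0) - twopii - twopii by ring.
  have per (s : C) : cexp (s - twopii) = cexp s by rewrite -[LHS]cexp_period subrK.
  by rewrite opprD !per; ring.
(* The product of ['i], the derivative of [G] and the displacement [twopii] is [- 2 pi k], so
   nonnegativity of [Re k] on the circle becomes an upper bound for the mean value theorem. *)
have B : complex.Re ('i * G (s0 + twopii) - 'i * G s0) <= 0.
  apply: (@Re_mvt R (fun s => 'i * G s) (fun s => 'i * k (cexp s))) => t ht.
    apply: cderZ; apply: dG; rewrite (addrC s0 twopii) addrK /lhp.
    rewrite cReD cReMl cReM cRe_i cIm_i /= !(mul0r, mulr0, subr0, addr0).
    by rewrite ln_lt0 // r0.
  rewrite (addrC s0 twopii) addrK.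
  set w := k _; have w0 : 0 <= complex.Re w.
    apply: Hr; rewrite nm_cexp cReD cReMl cReM cRe_i cIm_i /= !(mul0r, mulr0, subr0, addr0).
    by rewrite lnK // posrE.
  have -> : 'i * w * twopii = RtoC (- (2 * pi)) * w.
    by apply: C_eq; rewrite ?(cReM, cImM) ?cRe_i ?cIm_i /=; ring.
  by rewrite cReMl mulNr oppr_le0 mulr_ge0 // mulr_ge0 // pi_ge0.
move: B; rewrite -mulrBr HG.
have -> : 'i * (l * twopii) = RtoC (- (2 * pi)) * l.
  by apply: C_eq; rewrite ?(cReM, cImM) ?cRe_i ?cIm_i /=; ring.
by rewrite cReMl mulNr oppr_le0 pmulr_rge0 // mulr_gt0 // pi_gt0.
Qed.

Lemma le_of_scaled (x M : R) : 0 <= M -> (forall r : R, 0 < r < 1 -> x * r <= M) -> x <= M.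
Proof.
move=> M0 H; rewrite leNgt; apply/negP => Mx.
have x0 : 0 < x by exact: le_lt_trans Mx.
have : 0 < (M + x) / (2 * x) < 1.
  by rewrite divr_gt0 ?mulr_gt0 ?ltr_wpDl //= ltr_pdivrMr ?mulr_gt0 //; lra.
move=> /H; have -> : x * ((M + x) / (2 * x)) = (M + x) / 2 by field; rewrite gt_eqF.
lra.
Qed.

(** Dividing by [z] moves the first Taylor coefficient to the constant term. On [|z| = r] the
    constant [M / r] dominates [u f / z], so positivity of the mean applies to their difference. As
    [f] is controlled only in the open disk, this is done for every [r < 1]. *)
Lemma cauchy_estimate f a (M rho : R) (l : C) : 0 < rho ->
  (forall z, nm (z - a) < rho -> exists l, cder f z l) ->
  (forall z, nm (z - a) < rho -> nm (f z) <= M) ->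
  cder f a l -> nm l <= M / rho.
Proof.
move=> rho0 df fM dfa; rewrite ler_pdivlMr // mulrC.
have -> : rho * nm l = nm (RtoC rho * l) by rewrite nmM nm_RtoC gtr0_norm.
have inb (z : C) : nm z < 1 -> nm (a + RtoC rho * z - a) < rho.
  by move=> z1; rewrite (addrC a) addrK nmM nm_RtoC gtr0_norm // gtr_pMr.
have M0 : 0 <= M by apply: le_trans (fM a _); rewrite ?subrr ?nm0.
apply: le_of_scaled => // r /andP[r0 r1]; rewrite -ler_pdivlMr //.
apply: nm_le_rot => u u1.
pose k (z : C) := RtoC (M / r) - u * (f (a + RtoC rho * z) / z).
suff : 0 <= complex.Re (RtoC (M / r) - u * (RtoC rho * l)).
  by rewrite cReD cReN subr_ge0.
apply: (@mean_Re_ge0 k (- u * f a) 0 _ r); first by rewrite r0.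
- move=> z z0 z1; have [m Hm] := df _ (inb _ z1).
  have D : cder (fun z => a + RtoC rho * z) z (0 + RtoC rho * 1).
    by apply: cderD; [exact: cder_cst|apply: cderZ; exact: cder_id].
  have D2 := cderM (cder_comp D Hm) (cder_inv z0).
  eexists; apply: cderB; [exact: cder_cst|apply: cderZ; exact: D2].
- move=> e e0; have e'0 : 0 < e / rho by rewrite divr_gt0.
  have [d d0 Hd] := dfa _ e'0; exists (d / rho); first by rewrite divr_gt0.
  move=> z z0; rewrite ltr_pdivlMr // => zd.
  have nz : nm (RtoC rho * z) = nm z * rho by rewrite nmM nm_RtoC gtr0_norm // mulrC.
  have := Hd (RtoC rho * z); rewrite nz => /(_ zd) H.
  have -> : k z - (- u * f a) / z - 0 / z ^+ 2 - (RtoC (M / r) - u * (RtoC rho * l)) =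
    - u * ((f (a + RtoC rho * z) - f a - l * (RtoC rho * z)) / z).
    by rewrite /k; move: (RtoC (M / r)) (RtoC rho) => A B; field.
  rewrite nmM nmN u1 mul1r nmM nmV ler_pdivrMr ?nm_gt0 // (le_trans H) //.
  by rewrite mulrCA divfK ?gt_eqF // mulrC.
- move=> z zr; rewrite /k cReD cReN subr_ge0 (le_trans (ler_norm _)) //.
  have z1 : nm z < 1 by rewrite zr.
  rewrite (le_trans (Re_le_nm _)) // !nmM u1 mul1r nmV zr ler_wpM2r ?invr_ge0 ?(ltW r0) //.
  exact/fM/inb.
Qed.

(** Cauchy's estimate controls first derivatives only, so it is applied to functions built from [f]:
    to [f] itself, which bounds [f1]; to [f (u + k) - f u], which makes [f1] Lipschitz; and to a
    difference of two difference quotients of [f], whose derivatives at [z0] are the quotients [Q]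
    of [f1]. These are thus Cauchy as the increment tends to [0]. *)
Theorem derivative_holomorphic (D : C -> Prop) f f1 : opn D ->
  (forall z, D z -> cder f z (f1 z)) -> forall z, D z -> exists m, cder f1 z m.
Proof.
move=> oD df z0 Dz0.
have [d1 d10 H1] := oD _ Dz0.
have [d2 d20 H2] := cder_cont (df _ Dz0) ltr01.
(* [f] is bounded on the disk of radius [4 * rho], hence [f1] on that of radius [3 * rho]; around a
   point of the disk of radius [rho] this leaves room for one Cauchy disk and one increment. *)
pose M := nm (f z0) + 1; pose rho := Num.min d1 d2 / 4.
have r0 : 0 < rho by rewrite divr_gt0 // lt_min d10.
have HD z : nm (z - z0) < 4 * rho -> D z /\ nm (f z) <= M.
  rewrite /rho mulrC divfK // lt_min => /andP[h1 h2].
  have zE : z = z0 + (z - z0) by rewrite addrC subrK.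
  rewrite zE; split; first exact: H1.
  have -> : f (z0 + (z - z0)) = f z0 + (f (z0 + (z - z0)) - f z0) by ring.
  by rewrite (le_trans (nmD _ _)) // lerD2l; exact: H2.
have M0 : 0 <= M by rewrite addr_ge0.
have S1 z : nm (z - z0) < 3 * rho -> nm (f1 z) <= M / rho.
  move=> hz.
  have hw w : nm (w - z) < rho -> nm (w - z0) < 4 * rho.
    by move=> hw; have := nmBD z w z0; lra.
  apply: (@cauchy_estimate f z) => //.
  - by move=> w /hw /HD[Dw _]; exists (f1 w); exact: df.
  - by move=> w /hw /HD[].
  - by apply: df; apply: (HD z _).1; lra.
pose L := M / rho.
have S2 z w : nm (z - z0) < 3 * rho -> nm (w - z0) < 3 * rho ->
    nm (f w - f z) <= L * nm (w - z).
  move=> hz hw; apply: (@nm_mvt R f f1) => t ht; have hs := seg_convex hz hw ht.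
    by apply: df; apply: (HD _ _).1; lra.
  exact: S1.
have cderk k z : D (z + k) -> cder (fun u => f (u + k)) z (f1 (z + k)).
  move=> Dk; have A : cder (fun u : C => u + k) z 1.
    by rewrite -[1]addr0; exact: cderD (cder_id _) (cder_cst _ _).
  by have := cder_comp A (df _ Dk); rewrite mulr1.
have S3 z k : nm (z - z0) < rho -> nm k < rho ->
    nm (f1 (z + k) - f1 z) <= L / rho * nm k.
  move=> hz hk; rewrite mulrAC.
  have hw w : nm (w - z) < rho -> nm (w - z0) < 2 * rho /\ nm (w + k - z0) < 3 * rho.
    move=> hw; have h := nmBD z w z0; split; first by lra.
    by rewrite addrAC (le_lt_trans (nmD _ _)) //; lra.
  have cd w : nm (w - z) < rho -> cder (fun u => f (u + k) - f u) w (f1 (w + k) - f1 w).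
    move=> /hw[h1 h2]; apply: cderB; first by apply: cderk; apply: (HD _ _).1; lra.
    by apply: df; apply: (HD _ _).1; lra.
  apply: (@cauchy_estimate (fun u => f (u + k) - f u) z) => //.
  - by move=> w /cd ?; exists (f1 (w + k) - f1 w).
  - move=> w /hw[h1 h2]; have h3 : nm (w - z0) < 3 * rho by have := r0; lra.
    have := S2 w (w + k) h3 h2; have -> : w + k - w = k by rewrite (addrC w) addrK.
    by [].
  - by apply: cd; rewrite subrr nm0.
pose L1 := L / rho.
have rge : 0 <= rho by exact: ltW.
have L10 : 0 <= L1 by exact: (divr_ge0 (divr_ge0 M0 rge) rge).
have S4 z k : nm (z - z0) < rho -> nm k < rho ->
    nm (f (z + k) - f z - f1 z * k) <= L1 * nm k * nm k.
  move=> hz hk.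
  have -> : f (z + k) - f z - f1 z * k = (f (z + k) - f1 z * (z + k)) - (f z - f1 z * z) by ring.
  have := @nm_mvt R (fun u => f u - f1 z * u) (fun u => f1 u - f1 z) z (z + k) (L1 * nm k).
  rewrite (addrC z k) addrK; apply=> t ht.
    apply: cderB; last by have := cderZ (f1 z) (cder_id (z + RtoC t * k)); rewrite mulr1.
    apply: df; apply: (HD _ _).1; rewrite addrAC (le_lt_trans (nmD _ _)) //.
    rewrite nmM nm_RtoC ger0_norm; last by case/andP: ht.
    have : t * nm k <= 1 * nm k by rewrite ler_wpM2r //; case/andP: ht.
    lra.
  have tk : nm (RtoC t * k) <= nm k.
    by rewrite nmM nm_RtoC ger0_norm ?ler_piMl //; case/andP: ht.
  rewrite (le_trans (S3 z (RtoC t * k) hz _)) ?(le_lt_trans tk) //.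
  by rewrite ler_wpM2l.
pose Q k := (f1 (z0 + k) - f1 z0) / k.
have S5 k k' : k != 0 -> k' != 0 -> nm k < rho -> nm k' < rho ->
    nm (Q k - Q k') <= L1 / rho * (nm k + nm k').
  move=> k0 k'0 hk hk'; rewrite mulrAC.
  pose q k u := (f (u + k) - f u) / k.
  have dq k1 w : nm k1 < rho -> nm (w - z0) < rho ->
      cder (q k1) w ((f1 (w + k1) - f1 w) / k1).
    move=> h1 h2; rewrite /q mulrC.
    have B : cder (fun u => k1^-1 * (f (u + k1) - f u)) w (k1^-1 * (f1 (w + k1) - f1 w)).
      apply: cderZ; apply: cderB.
        apply: cderk; apply: (HD _ _).1; rewrite addrAC (le_lt_trans (nmD _ _)) //; lra.
      by apply: df; apply: (HD _ _).1; lra.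
    by apply: cder_near (ltr01) _ B => h _; rewrite mulrC.
  have qb k1 w : k1 != 0 -> nm k1 < rho -> nm (w - z0) < rho ->
      nm (q k1 w - f1 w) <= L1 * nm k1.
    move=> h0 h1 h2; have -> : q k1 w - f1 w = (f (w + k1) - f w - f1 w * k1) / k1.
      by rewrite /q; field.
    rewrite nmM nmV ler_pdivrMr ?nm_gt0 //; exact: S4.
  apply: (@cauchy_estimate (fun u => q k u - q k' u) z0) => //.
  - move=> w hw; eexists; apply: cderB; exact: dq.
  - move=> w hw; rewrite (le_trans (nmBD (f1 w) _ _)) // mulrDr.
    by rewrite lerD ?qb // nm_subC qb.
  - by apply: cderB; apply: dq => //; rewrite subrr nm0.
have L20 : 0 <= L1 / rho by exact: divr_ge0.
pose K := L1 / rho + 1; have K0 : 0 < K by rewrite ltr_wpDl.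
(* The shift [n.+2] puts the increment strictly below [rho] already at [n = 0]. *)
pose kn n : C := RtoC (rho / n.+2%:R).
have nkn n : nm (kn n) = rho / n.+2%:R.
  by rewrite nm_RtoC ger0_norm // divr_ge0 // ltW.
have kn0 n : kn n != 0 by rewrite -nm_gt0 nkn divr_gt0.
have knr n : nm (kn n) < rho.
  by rewrite nkn ltr_pdivrMr // ltr_pMr // ltr1n.
have ksmall (e : R) : 0 < e -> exists N, forall n, (N <= n)%N -> nm (kn n) <= e.
  move=> e0; exists (Num.truncn (rho / e)) => n hn; rewrite nkn ler_pdivrMr //.
  rewrite mulrC -ler_pdivrMr //.
  have := truncnS_gt (rho / e) => /ltW h; rewrite (le_trans h) // ler_nat.
  by rewrite ltnS (leq_trans hn).
have [m Hm] : exists m : C, (fun n => Q (kn n)) @ \oo --> m.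
  apply: cauchyC => e e0; have e'0 : 0 < e / K / 2 by rewrite !divr_gt0.
  have [N HN] := ksmall _ e'0; exists N => p q hp hq.
  rewrite (le_trans (S5 _ _ (kn0 p) (kn0 q) (knr p) (knr q))) //.
  have : nm (kn p) + nm (kn q) <= e / K by have := HN _ hp; have := HN _ hq; lra.
  rewrite ler_pdivlMr // mulrC => h; apply: le_trans h.
  by rewrite ler_wpM2r ?addr_ge0 // /K lerDl.
(* Letting the second increment of [S5] run along [kn] upgrades the sequential limit [m] to a limit
   over all increments, with a linear rate. *)
have S6 k : k != 0 -> nm k < rho -> nm (Q k - m) <= L1 / rho * nm k.
  move=> k0 kr; apply/ler_addgt0Pr => e e0.
  have e20 : 0 < e / 2 by rewrite divr_gt0.
  have e'0 : 0 < e / 2 / K by rewrite !divr_gt0.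
  have [N1 HN1] := ksmall _ e'0.
  have /cvgC /(_ _ e20) [N2 _ HN2] := Hm.
  pose n := maxn N1 N2.
  have h1 := HN1 n (leq_maxl _ _); have h2 := HN2 n (leq_maxr _ _).
  have h3 := S5 _ _ k0 (kn0 n) kr (knr n).
  have h4 : L1 / rho * nm (kn n) <= e / 2.
    move: h1; rewrite ler_pdivlMr // mulrC; apply: le_trans.
    by rewrite ler_wpM2r // /K lerDl.
  have := nmBD (Q (kn n)) (Q k) m; move: h2 h3 h4 => /=; rewrite mulrDr; lra.
exists m => e e0.
exists (Num.min rho (e / K)); first by rewrite lt_min r0 divr_gt0.
move=> h; rewrite lt_min => /andP[h1 h2].
have [->|h0] := eqVneq h 0; first by rewrite addr0 subrr mulr0 subr0 nm0 mulr0.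
have -> : f1 (z0 + h) - f1 z0 - m * h = (Q h - m) * h by rewrite /Q; field.
rewrite nmM ler_wpM2r // (le_trans (S6 _ h0 h1)) //.
move: h2; rewrite ltr_pdivlMr // mulrC => /ltW; apply: le_trans.
by rewrite ler_wpM2r // /K lerDl.
Qed.

(** Mean value inequality for [f] minus its quadratic polynomial: the derivative of the difference
    is the first-order remainder of [f1], which is already small compared with [h]. *)
Lemma taylor2 (D : C -> Prop) f f1 (f2 : C) z0 : opn D ->
  (forall z, D z -> cder f z (f1 z)) -> D z0 -> cder f1 z0 f2 ->
  forall e : R, 0 < e -> exists2 d : R, 0 < d & forall h, nm h < d ->
    nm (f (z0 + h) - f z0 - f1 z0 * h - f2 / 2 * h ^+ 2) <= e * nm h ^+ 2.
Proof.
move=> oD df Dz0 df1 e e0.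
have [d1 d10 H1] := oD _ Dz0; have [d2 d20 H2] := df1 _ e0.
exists (Num.min d1 d2); first by rewrite lt_min d10.
move=> h; rewrite lt_min => /andP[h1 h2].
pose G u := f u - f1 z0 * u - f2 / 2 * ((u - z0) * (u - z0)).
have -> : f (z0 + h) - f z0 - f1 z0 * h - f2 / 2 * h ^+ 2 = G (z0 + h) - G z0.
  by rewrite /G; ring.
have := @nm_mvt R G (fun u => f1 u - f1 z0 - f2 * (u - z0)) z0 (z0 + h) (e * nm h).
rewrite (addrC z0 h) addrK expr2 mulrA; apply=> t /andP[t0 t1].
all: have th : nm (RtoC t * h) <= nm h by rewrite nmM nm_RtoC ger0_norm // ler_piMl.
  have D1 : cder (fun u : C => u - z0) (z0 + RtoC t * h) 1.
    by rewrite -[1]subr0; exact: cderB (cder_id _) (cder_cst _ _).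
  have A : cder f (z0 + RtoC t * h) (f1 (z0 + RtoC t * h)).
    by apply: df; apply: H1; exact: le_lt_trans h1.
  have := cderB (cderB A (cderZ (f1 z0) (cder_id _))) (cderZ (f2 / 2) (cderM D1 D1)).
  by congr (cder _ _ _); field.
have -> : z0 + RtoC t * h - z0 = RtoC t * h by rewrite (addrC z0) addrK.
by rewrite (le_trans (H2 _ (le_lt_trans th h2))) // ler_wpM2l // (ltW e0).
Qed.

End MeanProperty.

(** * The second-order coefficient inequality for self-maps of the disk fixing the origin *)

Section SchwarzPick.
Context {R : realType}.
Local Notation C := (Cpx R).
Implicit Types (f g : C -> C) (a b c z : C).

Lemma lim0_cst c : lim0 (fun=> c) c.
Proof. by move=> e e0; exists 1 => // z _ _; rewrite subrr nm0 (ltW e0). Qed.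

Lemma lim0_id : lim0 (fun z => z) 0.
Proof. by move=> e e0; exists e => // z _ ze; rewrite subr0 (ltW ze). Qed.

Lemma lim0D f g (l m : C) : lim0 f l -> lim0 g m -> lim0 (fun z => f z + g z) (l + m).
Proof.
move=> Hf Hg e e0; have e20 : 0 < e / 2 by rewrite divr_gt0.
have [d1 d10 H1] := Hf _ e20; have [d2 d20 H2] := Hg _ e20.
exists (Num.min d1 d2); first by rewrite lt_min d10.
move=> z z0; rewrite lt_min => /andP[z1 z2].
rewrite opprD addrACA (le_trans (nmD _ _)) //.
by have := H1 z z0 z1; have := H2 z z0 z2; lra.
Qed.

Lemma lim0M f g (l m : C) : lim0 f l -> lim0 g m -> lim0 (fun z => f z * g z) (l * m).
Proof.
move=> Hf Hg e e0.
have K0 : 0 < 1 + nm l + nm m by rewrite -addrA ltr_pwDl // addr_ge0.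
pose e1 := Num.min 1 (e / (1 + nm l + nm m)).
have e10 : 0 < e1 by rewrite lt_min ltr01 divr_gt0.
have e11 : e1 <= 1 by rewrite ge_min lexx.
have e1e : e1 * (1 + nm l + nm m) <= e by rewrite -ler_pdivlMr // ge_min lexx orbT.
have [d1 d10 H1] := Hf _ e10; have [d2 d20 H2] := Hg _ e10.
exists (Num.min d1 d2); first by rewrite lt_min d10.
move=> z z0; rewrite lt_min => /andP[z1 z2].
have h1 := H1 z z0 z1; have h2 := H2 z z0 z2.
have -> : f z * g z - l * m = (f z - l) * (g z - m) + (l * (g z - m) + (f z - l) * m) by ring.
rewrite (le_trans (nmD _ _)) // (le_trans (lerD (lexx _) (nmD _ _))) // !nmM.
have a1 : nm (f z - l) * nm (g z - m) <= e1 * 1.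
  by rewrite ler_pM // (le_trans h2).
have a2 : nm l * nm (g z - m) <= nm l * e1 by rewrite ler_wpM2l.
have a3 : nm (f z - l) * nm m <= e1 * nm m by rewrite ler_wpM2r.
lra.
Qed.

Lemma lim0_ext f g (l : C) : (forall z, z != 0 -> f z = g z) -> lim0 f l -> lim0 g l.
Proof.
move=> E H e e0; have [d d0 Hd] := H e e0; exists d => // z z0 zd.
by rewrite -E //; exact: Hd.
Qed.

Definition udisk z := nm z < 1.

Lemma udisk_opn : opn udisk.
Proof.
by move=> z hz; have := @disk_opn R 0 1 z; rewrite subr0 => /(_ hz)[d d0 Hd];
  exists d => // h /Hd; rewrite subr0.
Qed.

Lemma udisk0 : udisk 0. Proof. by rewrite /udisk nm0. Qed.

Lemma cRe_conj (z : C) : complex.Re (z^*) = complex.Re z.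
Proof. by case: z. Qed.

Lemma cIm_conj (z : C) : complex.Im (z^*) = - complex.Im z.
Proof. by case: z. Qed.

Lemma mul_conj (z : C) : z * z^* = RtoC (nm z ^+ 2).
Proof. by rewrite -normCK nmE RtoCX. Qed.

(** Multiplication by [|1 - w|^2] turns the real part into [1 - |w|^2]. *)
Lemma cayley_Re_ge0 (w : C) : nm w < 1 -> 0 <= complex.Re ((1 + w) / (1 - w)).
Proof.
move=> w1; have v0 : 1 - w != 0.
  by apply: contraTneq w1 => /eqP; rewrite subr_eq0 => /eqP <-; rewrite nm1 ltxx.
have n0 : 0 < nm (1 - w) ^+ 2 by rewrite exprn_gt0 // nm_gt0.
rewrite -(pmulr_rge0 _ n0) -cReMl -mul_conj.
have -> : (1 - w) * (1 - w)^* * ((1 + w) / (1 - w)) = (1 + w) * (1 - w)^* by field.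
have : nm w ^+ 2 <= 1 by rewrite exprn_ile1 // ltW.
rewrite nm_sqr cReM cRe_conj cIm_conj !(cReD, cImD, cReN, cImN) /=; nra.
Qed.

(** The value of [be] completes the square in [|be|^2 + 2 Re (conj be * (r a + ga * conj (r a)))].
    With [u] arbitrary the claim is a polynomial identity in real and imaginary parts; [|u| = 1] is
    imposed only afterwards. *)
Lemma quad_form_value (r : R) (a b u : C) :
  let ga := - u^* in let be := - (RtoC r * a + ga * (RtoC r * a)^*) in
  complex.Re (1 + be * be^* + ga * ga^* + (be^* + be * ga^*) * RtoC r * (2 * a) +
    ga^* * RtoC r ^+ 2 * (2 * (b + a ^+ 2))) =
  (1 + (complex.Re u ^+ 2 + complex.Im u ^+ 2)) * (1 - r ^+ 2 * nm a ^+ 2)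
    - 2 * r ^+ 2 * complex.Re (u * b).
Proof.
move=> ga be; rewrite nm_sqr /be /ga !expr2.
rewrite !(cReM, cImM, cReD, cImD, cReN, cImN, cRe_conj, cIm_conj) /=; ring.
Qed.

(* Caratheodory's inequality for [p = (1 + w) / (1 - w)] tested against the
   trigonometric polynomial [|1 + beta e^(it) + gamma e^(2it)|^2]; the choice of [beta]
   below minimises the resulting quadratic form. *)
Lemma schwarz_order2 (w w1 : C -> C) (w2 : C) :
  (forall z, udisk z -> cder w z (w1 z)) -> w 0 = 0 ->
  (forall z, udisk z -> nm (w z) < 1) -> cder w1 0 w2 ->
  nm (w2 / 2) <= 1 - nm (w1 0) ^+ 2.
Proof.
move=> dw w00 wU dw1.
pose a := w1 0; pose b := w2 / 2.
have v0 z : udisk z -> 1 - w z != 0.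
  move=> /wU h; apply: contraTneq h => /eqP; rewrite subr_eq0 => /eqP <-.
  by rewrite nm1 ltxx.
pose p z := (1 + w z) / (1 - w z).
pose p1 z := 2 * w1 z * ((1 - w z) * (1 - w z))^-1.
have d1w z : udisk z -> cder (fun z => 1 - w z) z (0 - w1 z).
  by move=> hz; apply: cderB; [exact: cder_cst|exact: dw].
have dp z : udisk z -> cder p z (p1 z).
  move=> hz.
  have A := cderM (cderD (cder_cst 1 z) (dw _ hz)) (@cderV _ (fun z => 1 - w z) z _ (v0 _ hz) (d1w _ hz)).
  by move: A; congr (cder _ _ _); rewrite /p1; field; exact: v0.
(* [p] expands as [1 + 2 a z + 2 (b + a^2) z^2 + ...]; [eta] below is the remainder after these
   terms divided by [z^2]. *)
pose q := 2 * (b + a ^+ 2).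
have dp1 : cder p1 0 (2 * q).
  have h0 := udisk0; have vv : (1 - w 0) * (1 - w 0) != 0 by rewrite mulf_neq0 ?v0.
  have A := cderM (cderZ 2 dw1) (@cderV _ (fun z => (1 - w z) * (1 - w z)) 0 _ vv
    (cderM (d1w _ h0) (d1w _ h0))).
  move: A; congr (cder _ _ _); by rewrite w00 /q /b /a !subr0 !mulr1; field.
have P0 : p 0 = 1 by rewrite /p w00 addr0 subr0 divff // oner_neq0.
have P1 : p1 0 = 2 * a by rewrite /p1 w00 subr0 mulr1 invr1 mulr1.
pose eta z := (p z - 1 - 2 * a * z - q * z ^+ 2) / z ^+ 2.
have leta : lim0 eta 0.
  move=> e e0; have [d d0 Hd] := taylor2 udisk_opn dp udisk0 dp1 e0.
  exists d => // z z0 zd; rewrite subr0 /eta nmM nmV nmX.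
  rewrite ler_pdivrMr ?exprn_gt0 ?nm_gt0 //.
  by have := Hd z zd; rewrite add0r P0 P1 (mulrAC 2 q) divff ?mul1r // pnatr_eq0.
(* The inequality is needed on each circle [|z| = r]. It involves [r ^+ 2], so [r] is taken as a
   square root of the scaling factor, and [u] rotates [b] onto the nonnegative axis. *)
suff H (r : R) (u : C) : 0 < r < 1 -> nm u = 1 ->
    0 <= 1 - r ^+ 2 * nm a ^+ 2 - r ^+ 2 * complex.Re (u * b).
  have [u u1 ub] := nm_rotate b.
  suff : nm b + nm a ^+ 2 <= 1 by rewrite -lerBrDr.
  apply: le_of_scaled => // s /andP[s0 s1].
  have := H (Num.sqrt s) u; rewrite (sqr_sqrtr (ltW s0)) ub /= => /(_ _ u1) h.
  suff /h : 0 < Num.sqrt s < 1 by lra.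
  by rewrite sqrtr_gt0 s0 -sqrtr1 ltr_sqrt.
move=> /andP[r0 r1] u1.
pose ga : C := - u^*; pose rc : C := RtoC r.
have rc0 : rc != 0 by rewrite RtoC_eq0 gt_eqF.
pose be : C := - (rc * a + ga * (rc * a)^*).
(* On [|z| = r] the conjugate of [z / r] is [r / z], so [S] is there the squared modulus of the test
   polynomial, while it stays holomorphic off [0]. *)
pose S z := (1 + be * (z / rc) + ga * (z / rc) ^+ 2) *
            (1 + be^* * (rc / z) + ga^* * (rc / z) ^+ 2).
(* Laurent coefficients of [S]: [A] and [B] for [z^-1] and [z^-2], [T0] for the constant, [U1] and
   [U2] for [z] and [z^2]. Hence [p * S] has polar part [(A + 2 a B) / z + B / z^2] and constant
   term [T0 + 2 a A + q B]. *)
pose A := (be^* + be * ga^*) * rc; pose B := ga^* * rc ^+ 2.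
pose T0 := 1 + be * be^* + ga * ga^*.
pose U1 := (be + ga * be^*) / rc; pose U2 := ga / rc ^+ 2.
have pE z : z != 0 -> p z = 1 + 2 * a * z + q * z ^+ 2 + eta z * z ^+ 2.
  by move=> z0; rewrite /eta; field.
have : 0 <= complex.Re (T0 + A * (2 * a) + B * q).
  apply: (@mean_Re_ge0 R (fun z => p z * S z) (A + B * (2 * a)) B _ r).
  - by rewrite r0.
  - move=> z z0 z1.
    have D1 : cder (fun z => z / rc) z (1 * rc^-1 + z * 0).
      exact: cderM (cder_id _) (cder_cst _ _).
    have D2 := cderZ rc (cder_inv z0).
    have := cderM (dp z z1) (cderM
      (cderD (cderD (cder_cst 1 z) (cderZ be D1)) (cderZ ga (cderM D1 D1)))
      (cderD (cderD (cder_cst 1 z) (cderZ be^* D2)) (cderZ ga^* (cderM D2 D2)))).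
    by move=> H; eexists; exact: H.
  - apply: (@lim0_ext (fun z => (T0 + U1 * z + U2 * (z * z)) *
      (1 + 2 * a * z + q * (z * z) + eta z * (z * z)) +
      A * (2 * a + q * z + eta z * z) + B * (q + eta z))).
      move=> z z0; rewrite pE // /S /T0 /U1 /U2 /A /B; field.
      by rewrite z0 rc0.
    have -> : T0 + A * (2 * a) + B * q = (T0 + U1 * 0 + U2 * (0 * 0)) *
      (1 + 2 * a * 0 + q * (0 * 0) + 0 * (0 * 0)) +
      A * (2 * a + q * 0 + 0 * 0) + B * (q + 0) by ring.
    have LZ := lim0_id; have LZ2 := lim0M LZ LZ.
    have L1 := lim0D (lim0D (lim0_cst T0) (lim0M (lim0_cst U1) LZ)) (lim0M (lim0_cst U2) LZ2).
    have L2 := lim0D (lim0D (lim0D (lim0_cst 1) (lim0M (lim0_cst (2 * a)) LZ))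
      (lim0M (lim0_cst q) LZ2)) (lim0M leta LZ2).
    have L3 := lim0M (lim0_cst A) (lim0D (lim0D (lim0_cst (2 * a))
      (lim0M (lim0_cst q) LZ)) (lim0M leta LZ)).
    have L4 := lim0M (lim0_cst B) (lim0D (lim0_cst q) leta).
    exact: lim0D (lim0D (lim0M L1 L2) L3) L4.
  - move=> z zr.
    have z0 : z != 0 by rewrite -nm_gt0 zr.
    have z1 : udisk z by rewrite /udisk zr.
    have zc : (z / rc)^* = rc / z.
      have nz : nm (z / rc) = 1.
        by rewrite nmM nmV zr nm_RtoC gtr0_norm // divff ?gt_eqF.
      have zr0 : z / rc != 0 by rewrite mulf_neq0 ?invr_eq0.
      apply: (mulfI zr0); rewrite mul_conj nz expr1n RtoC1; field.
      by rewrite z0 rc0.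
    have SE : S z = RtoC (nm (1 + be * (z / rc) + ga * (z / rc) ^+ 2) ^+ 2).
      rewrite -mul_conj /S; move: (z / rc) zc => zeta zc.
      by rewrite !expr2 !rmorphD !rmorphM rmorph1 /= zc.
    rewrite SE mulrC cReMl mulr_ge0 ?sqr_ge0 //; exact: cayley_Re_ge0 (wU _ z1).
have -> : complex.Re (T0 + A * (2 * a) + B * q) =
  2 * (1 - r ^+ 2 * nm a ^+ 2 - r ^+ 2 * complex.Re (u * b)).
  have u2 : complex.Re u ^+ 2 + complex.Im u ^+ 2 = 1 by rewrite -nm_sqr u1 expr1n.
  transitivity ((1 + (complex.Re u ^+ 2 + complex.Im u ^+ 2)) *
    (1 - r ^+ 2 * nm a ^+ 2) - 2 * r ^+ 2 * complex.Re (u * b)); last by rewrite u2; ring.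
  exact: quad_form_value.
lra.
Qed.

End SchwarzPick.

(** * Norming functionals through minimal sublinear functionals *)

Section HahnBanach.
Context {R : realType} {X : normedModType (Cpx R)}.
Local Notation C := (Cpx R).
Implicit Types (q p : X -> R) (x y v : X).

Definition sublinear q :=
  (forall x y, q (x + y) <= q x + q y) /\
  (forall (r : R) x, 0 <= r -> q (RtoC r *: x) = r * q x).

Lemma sublinear0 q : sublinear q -> q 0 = 0.
Proof. by move=> [_ h]; rewrite -(scale0r (0 : X)) -RtoC0 h // mul0r. Qed.

Lemma sublinear_opp q x : sublinear q -> - q (- x) <= q x.
Proof.
move=> hq; rewrite -subr_ge0 opprK -(sublinear0 hq) -(subrr x).
by case: hq.
Qed.

(* A sublinear functional below [q] taking [- v] below [- q v]: comparing a minimal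
   sublinear functional with it shows that minimality forces linearity. *)
Definition flatten_dir q v y : R :=
  inf [set q (y + RtoC t *: v) - t * q v | t in [set t : R | 0 <= t]].

Section Flatten.
Variables (q : X -> R) (v : X).
Hypothesis hq : sublinear q.

Let S y := [set q (y + RtoC t *: v) - t * q v | t in [set t : R | 0 <= t]].

Let Slb y : lbound (S y) (- q (- y)).
Proof.
move=> _ [t /= t0 <-]; have [qD qZ] := hq.
rewrite -(qZ _ _ t0) lerBrDl lerBlDr.
by rewrite (le_trans _ (qD _ _)) // addrAC subrr add0r.
Qed.

Let Sne y : S y !=set0.
Proof. by exists (q (y + RtoC 0 *: v) - 0 * q v); exists 0 => //=. Qed.

Lemma flatten_le y (t : R) : 0 <= t -> flatten_dir q v y <= q (y + RtoC t *: v) - t * q v.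
Proof.
by move=> t0; apply: ge_inf; [exists (- q (- y)); exact: Slb|exists t].
Qed.

Lemma flatten_le_self y : flatten_dir q v y <= q y.
Proof.
by have := flatten_le y (lexx 0); rewrite RtoC0 scale0r addr0 mul0r subr0.
Qed.

Lemma flatten_ge y (m : R) :
  (forall t : R, 0 <= t -> m <= q (y + RtoC t *: v) - t * q v) -> m <= flatten_dir q v y.
Proof.
by move=> H; apply: lb_le_inf; [exact: Sne|move=> _ [t /= t0 <-]; exact: H].
Qed.

Lemma flatten_opp : flatten_dir q v (- v) <= - q v.
Proof.
have := flatten_le (- v) ler01; rewrite RtoC1 scale1r addNr mul1r.
by rewrite (sublinear0 hq) sub0r.
Qed.

Lemma flatten_sublinear : sublinear (flatten_dir q v).
Proof.
have [qD qZ] := hq; split=> [x y|r x r0].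
  rewrite -lerBlDr; apply: flatten_ge => t t0.
  rewrite lerBlDr -lerBlDl; apply: flatten_ge => s s0.
  rewrite lerBlDl; have := flatten_le (x + y) (addr_ge0 s0 t0).
  have -> : x + y + RtoC (s + t) *: v = (y + RtoC s *: v) + (x + RtoC t *: v).
    by rewrite RtoCD scalerDl (addrC x y) addrACA.
  move=> h; apply: (le_trans h); have := qD (y + RtoC s *: v) (x + RtoC t *: v); lra.
have [->|rn0] := eqVneq r 0.
  rewrite RtoC0 scale0r mul0r; apply/eqP; rewrite eq_le; apply/andP; split.
    by rewrite (le_trans (flatten_le_self 0)) // (sublinear0 hq).
  by apply: flatten_ge => t t0; rewrite add0r qZ // subrr.
have rp : 0 < r by rewrite lt_neqAle eq_sym rn0.
apply/eqP; rewrite eq_le; apply/andP; split.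
  rewrite mulrC -ler_pdivrMr //; apply: flatten_ge => t t0; rewrite ler_pdivrMr //.
  have := flatten_le (RtoC r *: x) (mulr_ge0 r0 t0).
  by rewrite RtoCM -scalerA -scalerDr qZ // => h; apply: (le_trans h); lra.
apply: flatten_ge => t t0.
have h := flatten_le x (divr_ge0 t0 r0).
have -> : RtoC r *: x + RtoC t *: v = RtoC r *: (x + RtoC (t / r) *: v).
  by rewrite scalerDr scalerA -RtoCM mulrC divfK.
rewrite qZ //; have := ler_wpM2l r0 h; rewrite mulrBr mulrA (mulrC r (t / r)) divfK //.
Qed.

End Flatten.

(** Zorn's lemma for the reversed pointwise order. The infimum of a chain is finite thanks to the
    lower bound [- p (- x)], and subadditive because two members of a chain are comparable. *)
Lemma sublinear_min p : sublinear p -> exists q,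
  [/\ sublinear q, (forall x, q x <= p x) &
      forall s, sublinear s -> (forall x, s x <= q x) -> forall x, q x <= s x].
Proof.
move=> hp.
pose T := {q : X -> R | sublinear q /\ forall x, q x <= p x}.
pose le (q s : T) := `[< forall x, sval s x <= sval q x >].
have p0 : T by exists p.
have [|||q Hq] := @ZL_preorder T p0 le.
- by move=> q; apply/asboolP => x.
- move=> q r s /asboolP h1 /asboolP h2; apply/asboolP => x.
  exact: le_trans (h2 x) (h1 x).
- move=> A tot.
  have [[q0 Aq0]|nA] := pselect (exists q : T, A q); last first.
    by exists p0 => s As; exfalso; apply: nA; exists s.
  pose S x := [set sval q x | q in (A : set T)].
  have Slb x : lbound (S x) (- p (- x)).
    move=> _ [q Aq <-]; have [hq qp] := svalP q.
    by rewrite (le_trans _ (sublinear_opp x hq)) // lerN2.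
  have Sne x : S x !=set0 by exists (sval q0 x); exists q0.
  pose qi x := inf (S x).
  have qile (q : T) x : A q -> qi x <= sval q x.
    by move=> Aq; apply: ge_inf; [exists (- p (- x)); exact: Slb|exists q].
  have qige x (m : R) : (forall q : T, A q -> m <= sval q x) -> m <= qi x.
    by move=> H; apply: lb_le_inf => // _ [q Aq <-]; exact: H.
  have hqi : sublinear qi.
    split=> [x y|r x r0].
      rewrite -lerBlDr; apply: (qige) => q Aq.
      rewrite lerBlDr -lerBlDl; apply: (qige) => s As; rewrite lerBlDr.
      have [/asboolP h|/asboolP h] := tot _ _ Aq As.
        have [[sD _] _] := svalP s; apply: (le_trans (qile s _ As)).
        by have := sD x y; have := h x; lra.
      have [[sD _] _] := svalP q; apply: (le_trans (qile q _ Aq)).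
      by have := sD x y; have := h y; lra.
    have [->|rn0] := eqVneq r 0.
      rewrite RtoC0 scale0r mul0r; apply/eqP; rewrite eq_le; apply/andP; split.
        by have [hq _] := svalP q0; rewrite (le_trans (qile q0 _ Aq0)) // (sublinear0 hq).
      by apply: (qige) => q Aq; have [hq _] := svalP q; rewrite (sublinear0 hq).
    have rp : 0 < r by rewrite lt_neqAle eq_sym rn0.
    apply/eqP; rewrite eq_le; apply/andP; split.
      rewrite mulrC -ler_pdivrMr //; apply: (qige) => q Aq; rewrite ler_pdivrMr // mulrC.
      by have [[_ qZ] _] := svalP q; rewrite -qZ //; exact: qile.
    apply: (qige) => q Aq; have [[_ qZ] _] := svalP q; rewrite qZ //.
    by rewrite ler_wpM2l // qile.
  have hT : sublinear qi /\ forall x, qi x <= p x.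
    split=> // x; have [_ qp] := svalP q0; exact: le_trans (qile q0 x Aq0) (qp x).
  by exists (exist _ qi hT) => s As; apply/asboolP => x /=; exact: qile.
exists (sval q); have [hq qp] := svalP q; split=> // s hs sq.
have sp x : s x <= p x by exact: le_trans (sq x) (qp x).
by move=> x; have /asboolP := Hq (exist _ s (conj hs sp)) (asboolT sq); exact.
Qed.

Lemma nm_sublinear : sublinear (@nm R X).
Proof. by split=> [x y|r x r0]; [exact: nmD|rewrite nmZ nm_RtoC ger0_norm]. Qed.

(** A minimal [q] is odd, since [flatten_dir q v] lies below it and sends [- v] to at most [- q v];
    odd and subadditive gives additive. Starting from the norm flattened in the direction [x0]
    forces [q (- x0) <= - |x0|], which fixes the value at [x0] without any extension from a
    subspace. *)
Lemma real_hahn_banach (x0 : X) : exists q,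
  [/\ (forall x y, q (x + y) = q x + q y), (forall (r : R) x, q (RtoC r *: x) = r * q x),
      (forall x, q x <= nm x) & q x0 = nm x0].
Proof.
have [q [hq qp qmin]] := sublinear_min (flatten_sublinear x0 nm_sublinear).
have [qD qZ] := hq.
have qodd v : q (- v) = - q v.
  apply/eqP; rewrite eq_le; apply/andP; split; last by rewrite lerNl; exact: sublinear_opp.
  apply: le_trans (flatten_opp v hq).
  exact: (qmin _ (flatten_sublinear v hq) (flatten_le_self v hq)).
have qnm x : q x <= nm x by exact: le_trans (qp x) (flatten_le_self _ nm_sublinear _).
exists q; split=> //.
- move=> x y; apply/eqP; rewrite eq_le qD /=.
  have := qD (x + y) (- y); rewrite addrK qodd; lra.
- move=> r x; have [r0|r0] := lerP 0 r; first exact: qZ.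
  rewrite -[r]opprK RtoCN scaleNr qodd qZ ?oppr_ge0 ?ltW //; ring.
- apply/eqP; rewrite eq_le qnm /=.
  by have := le_trans (qp (- x0)) (flatten_opp x0 nm_sublinear); rewrite qodd lerN2.
Qed.

Theorem norming_functional (x0 : X) : exists T : {linear X -> C},
  (forall y, nm (T y) <= nm y) /\ T x0 = `|x0|.
Proof.
have [q [qD qZ qn q0]] := real_hahn_banach x0.
(* The only complex-linear functional with real part [q]; rotating the argument turns [q <= nm] into
   a bound on its modulus. *)
pose t y : C := RtoC (q y) - 'i * RtoC (q ('i *: y)).
have qN y : q (- y) = - q y by rewrite -scaleN1r -RtoC1 -RtoCN qZ mulN1r.
have tlin' c x y : t (c *: x + y) = c * t x + t y.
  rewrite /t [c]complexRI; move: (complex.Re c) (complex.Im c) => r s.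
  have ii z : 'i *: ('i *: z) = - z :> X by rewrite scalerA -expr2 sqrCi scaleN1r.
  rewrite !scalerDl !scalerDr !qD.
  have e1 z : q (('i * RtoC s) *: z) = s * q ('i *: z).
    by rewrite mulrC -scalerA qZ.
  have e2 z : q ('i *: (RtoC r *: z)) = r * q ('i *: z).
    by rewrite scalerA mulrC -scalerA qZ.
  have e3 z : q ('i *: (('i * RtoC s) *: z)) = - (s * q z).
    by rewrite -scalerA ii qN qZ.
  rewrite e1 e2 e3 qZ.
  by apply: C_eq; rewrite !(cReD, cImD, cReN, cImN, cReM, cImM) cRe_i cIm_i /=; ring.
have tlin : linear t by move=> c x y; exact: tlin'.
pose T : {linear X -> C} := HB.pack t (GRing.isLinear.Build _ _ _ _ t tlin).
have ReT y : complex.Re (T y) = q y.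
  by rewrite -[T y]/(t y) /t cReD cReN cReM cRe_i cIm_i /=; ring.
have Tn y : nm (T y) <= nm y.
  apply: nm_le_rot => u u1.
  have -> : u * T y = T (u *: y) by rewrite linearZ.
  by rewrite ReT (le_trans (qn _)) // nmZ u1 mul1r.
exists T; split=> //; rewrite nmE; apply: C_eq; first by rewrite ReT q0.
(* The real part at [x0] already exhausts the bound on the modulus, which leaves no room for an
   imaginary part. *)
have := Tn x0; rewrite -ler_sqr ?nnegrE // nm_sqr ReT q0 gerDl => h.
by apply/eqP; rewrite -sqrf_eq0 eq_le h sqr_ge0.
Qed.

End HahnBanach.

(** * Restriction of derivatives to a complex line *)

Section Lines.
Context {R : realType} {X : normedModType (Cpx R)}.
Local Notation C := (Cpx R).

(** A directional derivative sees only the line, so the values of [F] there near [t0] suffice. The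
    result is again a scalar function times [x0], so the lemma can be iterated for [D2] and [D3]. *)
Lemma derive_line (F : X -> X) (A : C -> C) (x0 : X) (t0 l c : C) (d : R) : 0 < d ->
  (forall h, nm h < d -> F ((t0 + h) *: x0) = A (t0 + h) *: x0) ->
  cder A t0 l -> derive F (t0 *: x0) (c *: x0) = (c * l) *: x0.
Proof.
move=> d0 FA dA; apply: cvg_lim; first exact: norm_hausdorff.
apply/cvgC => e e0.
have K0 : 0 < (nm c + 1) * (nm x0 + 1) by rewrite mulr_gt0 // ltr_wpDl.
have c0 : 0 < nm c + 1 by rewrite ltr_wpDl.
have x00 : 0 < nm x0 + 1 by rewrite ltr_wpDl.
have e'0 : 0 < e / ((nm c + 1) * (nm x0 + 1)) by rewrite divr_gt0.
have [d' d'0 Hd] := dA _ e'0.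
rewrite near_withinE; apply/(nearC (0 : C)).
exists (Num.min d d' / (nm c + 1)); first by rewrite divr_gt0 // lt_min d0.
move=> k; rewrite ltr_pdivlMr // lt_min add0r => /andP[k1 k2] k0.
have kc : nm (k * c) <= nm k * (nm c + 1) by rewrite nmM ler_wpM2l // lerDl.
have HD0 := Hd (k * c) (le_lt_trans kc k2).
have E1 : k *: (c *: x0) + t0 *: x0 = (t0 + k * c) *: x0.
  by rewrite scalerA -scalerDl addrC.
have E2 : F (t0 *: x0) = A t0 *: x0 by have := FA 0; rewrite nm0 addr0 => ->.
rewrite /= E1 FA; last exact: le_lt_trans k1.
rewrite E2 -scalerBl scalerA -scalerBl.
have -> : k^-1 * (A (t0 + k * c) - A t0) - c * l =
  k^-1 * (A (t0 + k * c) - A t0 - l * (k * c)) by field.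
have HD := le_trans HD0 (ler_wpM2l (ltW e'0) kc).
rewrite nmZ (nmM k^-1) nmV.
rewrite -mulrA ler_pdivrMl ?nm_gt0 //.
apply: (@le_trans _ _ (e / ((nm c + 1) * (nm x0 + 1)) * (nm k * (nm c + 1)) * (nm x0 + 1))).
  rewrite ler_pM ?nm_ge0 //; last by rewrite lerDl.
rewrite le_eqVlt; apply/orP; left; apply/eqP; field.
by rewrite !gt_eqF.
Qed.

Lemma line_cder (f : X -> C) (x0 : X) (t : C) : differentiable f (t *: x0) ->
  cder (fun t => f (t *: x0)) t ('D_x0 f (t *: x0)).
Proof.
move=> df; have H := @diff_derivable _ _ _ f (t *: x0) x0 df.
have /cvgC HH : (fun h : C => h^-1 *: ((f \o shift (t *: x0)) (h *: x0) - f (t *: x0))) @ 0^'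
  --> 'D_x0 f (t *: x0) by exact: H.
move=> e e0; have := HH e e0; rewrite near_withinE => /(nearC (0 : C))[d d0 Hd].
exists d => // h hd; have [->|h0] := eqVneq h 0.
  by rewrite addr0 subrr sub0r mulr0 oppr0 nm0 mulr0.
have := Hd h hd; rewrite add0r => /(_ h0) /=.
rewrite -scalerDl (addrC h t) -[_ *: (_ - _)]/(h^-1 * _).
move: ('D_x0 f (t *: x0)) => l.
have -> : h^-1 * (f ((t + h) *: x0) - f (t *: x0)) - l =
  h^-1 * (f ((t + h) *: x0) - f (t *: x0) - l * h) by field.
by rewrite nmM nmV ler_pdivrMl ?nm_gt0 // (mulrC (nm h)).
Qed.

(** [D2 F 0] at two multiples of [x0] is a multiple of [x0], so the nested second derivative stays
    on the line and becomes the square of [P2 0 / 2]. *)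
Lemma FS_on_line (F : X -> X) (x0 : X) (P P1 P2 : C -> C) (P3 n lam : C) :
  (forall t, udisk t -> F (t *: x0) = P t *: x0) ->
  (forall t, udisk t -> cder P t (P1 t)) -> (forall t, udisk t -> cder P1 t (P2 t)) ->
  cder P2 0 P3 ->
  FS_functional F lam (n *: x0) = (n ^+ 3 * (P3 / 6 - lam * (P2 0 / 2) ^+ 2)) *: x0.
Proof.
move=> FP dP dP1 dP2.
have D1 t : udisk t -> derive F (t *: x0) (n *: x0) = (n * P1 t) *: x0.
  move=> Ut; have [d d0 Hd] := udisk_opn Ut.
  by apply: (derive_line _ d0) (dP _ Ut) => h /Hd; exact: FP.
have D2E c t : udisk t -> D2 F (t *: x0) (n *: x0) (c *: x0) = (c * (n * P2 t)) *: x0.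
  move=> Ut; have [d d0 Hd] := udisk_opn Ut.
  rewrite /D2; apply: (@derive_line _ (fun t => n * P1 t) _ _ _ _ _ d0).
    by move=> h /Hd; exact: D1.
  by apply: cderZ; exact: dP1.
have D3E : D3 F 0 (n *: x0) (n *: x0) (n *: x0) = (n * (n * (n * P3))) *: x0.
  have [d d0 Hd] := udisk_opn (@udisk0 R).
  rewrite /D3 -(scale0r x0).
  apply: (@derive_line _ (fun t => n * (n * P2 t)) _ _ _ _ _ d0).
    by move=> h /Hd; exact: D2E.
  by do 2![apply: cderZ].
rewrite /FS_functional D3E.
have D20 c : D2 F 0 (n *: x0) (c *: x0) = (c * (n * P2 0)) *: x0.
  by rewrite -{1}(scale0r x0) D2E //; exact: udisk0.
rewrite !D20 !scalerA D20 scalerA -scalerBl; congr (_ *: _).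
have -> : (3`!)%:R = 6 :> C by [].
have -> : (2`!)%:R = 2 :> C by [].
by field.
Qed.

End Lines.

(** * Comparison of Taylor coefficients *)

Section Coefficients.
Context {R : realType}.
Local Notation C := (Cpx R).

Lemma holomorphic_tower (f : C -> C) : (forall z, udisk z -> exists l, cder f z l) ->
  [/\ forall z, udisk z -> cder f z ('D_1 f z),
      forall z, udisk z -> cder ('D_1 f) z ('D_1 ('D_1 f) z) &
      forall z, udisk z -> exists l, cder ('D_1 ('D_1 f)) z l].
Proof.
move=> df.
have H (h : C -> C) : (forall z, udisk z -> exists l, cder h z l) ->
    forall z, udisk z -> cder h z ('D_1 h z).
  by move=> dh z Uz; have [l Hl] := dh z Uz; rewrite (cder_val Hl).
have d1 := H _ df.
have d2 := H _ (derivative_holomorphic udisk_opn d1).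
by split=> //; exact: derivative_holomorphic udisk_opn d2.
Qed.

Lemma holomorphic_jet (f : C -> C) : (forall z, udisk z -> exists l, cder f z l) ->
  exists f1 f2, (forall z, udisk z -> cder f z (f1 z)) /\ cder f1 0 f2.
Proof.
move=> /holomorphic_tower[h1 h2 _].
by exists ('D_1 f), ('D_1 ('D_1 f) 0); split=> //; exact: (h2 _ (@udisk0 R)).
Qed.

(** With [q = 1 + k (g o w - 1)], differentiating [(t phi)' = phi q] twice at [0] gives
    [p1 0 = q1 0] and [p2 0 = (q1 0)^2 + q2 / 2], while [P3 / 6 = p2 0 / 2] and
    [P2 0 / 2 = p1 0]. *)
Lemma FS_coefficient (phi p1 p2 w w1 g g1 : C -> C) (w2 g2 k lam : C) :
  (forall z, udisk z -> cder phi z (p1 z)) -> (forall z, udisk z -> cder p1 z (p2 z)) ->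
  (forall z, udisk z -> exists l, cder p2 z l) ->
  (forall z, udisk z -> cder w z (w1 z)) -> cder w1 0 w2 ->
  (forall z, udisk z -> cder g z (g1 z)) -> cder g1 0 g2 ->
  (forall z, udisk z -> udisk (w z)) -> w 0 = 0 -> g 0 = 1 -> phi 0 = 1 -> g1 0 != 0 ->
  (forall z, udisk z -> phi z + z * p1 z = phi z * (1 + k * (g (w z) - 1))) ->
  exists P1 P2 P3, [/\ forall t, udisk t -> cder (fun t => t * phi t) t (P1 t),
    forall t, udisk t -> cder P1 t (P2 t), cder P2 0 P3 &
    P3 / 6 - lam * (P2 0 / 2) ^+ 2 =
      k * g1 0 / 2 * (w2 / 2 + ((1 - 2 * lam) * k * g1 0 + g2 / g1 0 / 2) * w1 0 ^+ 2)].
Proof.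
move=> dp dp1 dp2 dw dw1 dg dg' wU w0 g0 p0 g10 E.
have [p3 dp20] := dp2 _ (@udisk0 R).
pose P1 t := phi t + t * p1 t.
pose P2 t := 2 * p1 t + t * p2 t.
pose q t := 1 + k * (g (w t) - 1).
pose q1 t := k * (g1 (w t) * w1 t).
have dq t : udisk t -> cder q t (q1 t).
  move=> Ut; have := cderD (cder_cst 1 t) (cderZ k
    (cderB (cder_comp (dw _ Ut) (dg _ (wU _ Ut))) (cder_cst 1 t))).
  by rewrite add0r subr0.
pose q2 := k * (g2 * w1 0 ^+ 2 + g1 0 * w2).
have dq1 : cder q1 0 q2.
  have U0 := @udisk0 R; have dgw : cder g1 (w 0) g2 by rewrite w0.
  have := cderZ k (cderM (cder_comp (dw _ U0) dgw) dw1).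
  by congr (cder _ _ _); rewrite w0 /q2; ring.
have dP t : udisk t -> cder (fun t => t * phi t) t (P1 t).
  by move=> Ut; have := cderM (cder_id t) (dp _ Ut); rewrite mul1r.
have dP1 t : udisk t -> cder P1 t (P2 t).
  move=> Ut; have := cderD (dp _ Ut) (cderM (cder_id t) (dp1 _ Ut)).
  by congr (cder _ _ _); rewrite /P2; ring.
have dP2 : cder P2 0 (3 * p2 0).
  have U0 := @udisk0 R.
  have := cderD (cderZ 2 (dp1 _ U0)) (cderM (cder_id 0) dp20).
  by congr (cder _ _ _); ring.
(* The two expressions for [P1] agree on the disk only, so their derivatives are identified through
   locality and uniqueness. *)
have P2E t : udisk t -> P2 t = p1 t * q t + phi t * q1 t.
  move=> Ut; apply: (cder_uniq (dP1 _ Ut)); have [d d0 Hd] := udisk_opn Ut.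
  apply: cder_near d0 _ (cderM (dp _ Ut) (dq _ Ut)) => h /Hd Uh.
  by rewrite /P1 E.
have q0 : q 0 = 1 by rewrite /q w0 g0 subrr mulr0 addr0.
have e1 : p1 0 = q1 0.
  have := P2E _ (@udisk0 R); rewrite /P2 mul0r addr0 q0 p0 mulr1 mul1r.
  have -> : 2 * p1 0 = p1 0 + p1 0 by ring.
  by move=> /addrI.
have e2 : 3 * p2 0 = p2 0 + 2 * (p1 0 * q1 0) + q2.
  apply: (cder_uniq dP2); have U0 := @udisk0 R; have [d d0 Hd] := udisk_opn U0.
  have A := cderD (cderM (dp1 _ U0) (dq _ U0)) (cderM (dp _ U0) dq1).
  have : cder P2 0 (p2 0 * q 0 + p1 0 * q1 0 + (p1 0 * q1 0 + phi 0 * q2)).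
    by apply: cder_near d0 _ A => h /Hd Uh; rewrite P2E.
  by congr (cder _ _ _); rewrite q0 p0; ring.
exists P1, P2, (3 * p2 0); split=> //.
have e3 : p2 0 = p1 0 * q1 0 + q2 / 2.
  have -> : p2 0 = (3 * p2 0 - p2 0) / 2 by field.
  by rewrite e2; field.
rewrite /P2 mul0r addr0 e3 e1 /q1 /q2 w0.
by field.
Qed.

End Coefficients.

(** * The upper bound *)

Section Estimate.
Context {R : realType}.
Local Notation C := (Cpx R).
Variables (b : R) (g : C -> C).
Hypothesis hb : `|b| < pi / 2.
Hypothesis hg : biholomorphic_on unit_disk g.
Hypothesis g0 : g 0 = 1.
Hypothesis Reg : forall z, unit_disk z -> 0 < complex.Re (g z).

Lemma unit_diskE (z : C) : unit_disk z <-> udisk z.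
Proof. by rewrite /unit_disk /udisk /= nmE -RtoC1 RtoC_lt. Qed.

Lemma cos_pos : 0 < cos b.
Proof. by apply: cos_gt0_pihalf; rewrite -ltr_norml. Qed.

Definition eb : C := RtoC (cos b) - 'i * RtoC (sin b).
Definition ebc : C := RtoC (cos b) + 'i * RtoC (sin b).
Definition kb : C := eb * RtoC (cos b).

Lemma eb_ebc : eb * ebc = 1.
Proof.
have := cos2Dsin2 b; rewrite !expr2 => h.
apply: C_eq; rewrite /eb /ebc !(cReD, cImD, cReN, cImN, cReM, cImM) cRe_i cIm_i /=; lra.
Qed.

Lemma nm_eb : nm eb = 1.
Proof.
apply/eqP; rewrite -(@eqrXn2 _ 2) // ?nm_ge0 // expr1n nm_sqr.
rewrite !(cReD, cImD, cReN, cImN, cReM, cImM) cRe_i cIm_i /=.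
by have := cos2Dsin2 b; rewrite !expr2 => h; apply/eqP; lra.
Qed.

Lemma nm_kb : nm kb = cos b.
Proof. by rewrite nmM nm_eb mul1r nm_RtoC gtr0_norm // cos_pos. Qed.

Lemma kb_neq0 : kb != 0.
Proof. by rewrite -nm_gt0 nm_kb cos_pos. Qed.

Lemma g_betaE z : g_beta g b z = 1 + kb * (g z - 1).
Proof.
have -> : 1 + kb * (g z - 1) = kb * g z + (eb * ebc - kb) by rewrite eb_ebc; ring.
by rewrite /g_beta /kb /ebc -/eb; ring.
Qed.

(** After rotation by [e^{i beta}] the real part is [cos b * Re (g z) > 0]. This matters because the
    inverse of [0] is [0]: a quotient lying in the image of [g_beta] cannot come from a vanishing
    denominator. *)
Lemma g_beta_neq0 z : udisk z -> g_beta g b z != 0.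
Proof.
move=> /unit_diskE /Reg Rg; apply/eqP => h.
have : ebc * g_beta g b z = 0 by rewrite h mulr0.
rewrite /g_beta -/eb mulrA (mulrC ebc) eb_ebc mul1r => /(congr1 (@complex.Re R)).
rewrite cReD cReMl cReM cRe_i cIm_i /= !(mul0r, mulr0, subr0, addr0) => /eqP.
by rewrite mulf_eq0 !gt_eqF // cos_pos.
Qed.

(** The second term of the maximum in [psi_beta] times [e^{-i beta}], the form in which the Taylor
    coefficients produce it. *)
Definition mub (lam : C) : C := (1 - 2 * lam) * kb * dg1 g + dg2 g / dg1 g / 2.

Lemma psi_betaE lam : psi_beta g b lam = RtoC (cos b * Num.max 1 (nm (mub lam))).
Proof.
rewrite RtoCM /psi_beta; congr (_ * _).
have -> : (1 - 2 * lam) * RtoC (cos b) * dg1 g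
       + (RtoC (cos b) + 'i * RtoC (sin b)) / 2 * (dg2 g / dg1 g) = ebc * mub lam.
  have e : RtoC (cos b) = ebc * kb by rewrite /kb mulrA (mulrC ebc) eb_ebc mul1r.
  by rewrite {1}e /mub -/ebc; ring.
have ne : nm ebc = 1 by have := congr1 nm eb_ebc; rewrite nmM nm_eb mul1r nm1.
rewrite nmE nmM ne mul1r /Num.max /Order.max -RtoC1 RtoC_lt.
by case: ifP.
Qed.

Lemma g_cder z : udisk z -> exists l, cder g z l.
Proof.
by case: hg => dg _ _ /unit_diskE /dg dgz; exists ('D_1 g z); exact: differentiable_cder.
Qed.

(** Chain rule for [finv (g z) = z] at [0]. *)
Lemma dg1_neq0 : dg1 g != 0.
Proof.
have [dg _ [finv [fK df]]] := hg.
have U0 : unit_disk (0 : C) by apply/unit_diskE/udisk0.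
have Hg := differentiable_cder (dg _ U0).
have Hf := differentiable_cder (df (g 0) (ex_intro2 _ _ 0 U0 erefl)).
have [d d0 Hd] := udisk_opn (@udisk0 R).
have : cder (fun z => z) (0 : C) ('D_1 finv (g 0) * 'D_1 g 0).
  by apply: cder_near d0 _ (cder_comp Hg Hf) => h /Hd /unit_diskE /fK.
move=> /cder_uniq /(_ (cder_id 0)) h; apply/eqP => h0.
by move: h; rewrite -[X in _ * X]/(dg1 g) h0 mulr0 => /esym/eqP; rewrite oner_eq0.
Qed.

Lemma g_tower : exists g1 g2, [/\ forall z, udisk z -> cder g z (g1 z),
  cder g1 0 g2, g1 0 = dg1 g & g2 = dg2 g].
Proof.
have [dg dg' _] := holomorphic_tower g_cder.
by exists ('D_1 g), (dg2 g); split=> //; exact: (dg' _ (@udisk0 R)).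
Qed.

Theorem estimate (X : normedModType C) (F : X -> X) (lam : C) (x : X) :
  admissible g b F -> unit_ball x -> x != 0 ->
  `|FS_functional F lam x| <= `|x| ^+ 3 / 2 * psi_beta g b lam * `|dg1 g|.
Proof.
move=> [dF [[f [df Ff]] [F0 [DF0 [Finv [h [hF [_ hM]]]]]]]] xB x0.
have nx0 : nm x != 0 by rewrite nm_eq0.
pose n : C := RtoC (nm x); have n0 : n != 0 by rewrite RtoC_eq0.
have [e ne xE] : exists2 e : X, nm e = 1 & x = n *: e.
  exists (n^-1 *: x); last by rewrite scalerA divff // scale1r.
  by rewrite nmZ nmV nm_RtoC ger0_norm // mulVf.
have e0 : e != 0 by rewrite -nm_gt0 ne.
have Bt t : udisk t -> unit_ball (t *: e).
  by move=> Ut; rewrite /unit_ball /= nmE -RtoC1 RtoC_lt nmZ ne mulr1.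
have scale_inj (s t : C) : s *: e = t *: e -> s = t.
  by move=> /eqP; rewrite -subr_eq0 -scalerBl scaler_eq0 (negbTE e0) orbF subr_eq0 => /eqP.
pose phi t := f (t *: e).
have hphi t : udisk t -> exists l, cder phi t l.
  by move=> Ut; eexists; apply: line_cder; apply: df; exact: Bt.
have [dp dp1 dp2] := holomorphic_tower hphi.
have FP t : udisk t -> F (t *: e) = (t * phi t) *: e.
  by move=> Ut; rewrite (Ff _ (Bt _ Ut)) scalerA mulrC.
pose P1 t := phi t + t * 'D_1 phi t.
have dP t : udisk t -> cder (fun t => t * phi t) t (P1 t).
  by move=> Ut; have := cderM (cder_id t) (dp _ Ut); rewrite mul1r.
have dFe t : udisk t -> 'd F (t *: e) e = P1 t *: e.
  move=> Ut; rewrite -deriveE; last exact/dF/Bt.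
  have [d d0 Hd] := udisk_opn Ut.
  have := @derive_line R X F (fun t => t * phi t) e t (P1 t) 1 d d0.
  rewrite scale1r mul1r; apply; last exact: dP.
  by move=> k /Hd; exact: FP.
have phi0 : phi 0 = 1.
  have := dFe _ (@udisk0 R); rewrite scale0r DF0 /P1 mul0r addr0 -{1}(scale1r e).
  by move=> /scale_inj.
(* The class says nothing at the origin, so [t = 0] is settled by [phi 0 = 1]. Elsewhere injectivity
   of the derivative forces [h (t *: e)] to be a multiple of [e], and the norm cancels from the
   quotient. *)
have Hq t : udisk t -> exists2 z, udisk z & phi t != 0 /\ P1 t = phi t * (1 + kb * (g z - 1)).
  move=> Ut; have [->|t0] := eqVneq t 0.
    exists 0; first exact: udisk0.
    by rewrite phi0 oner_neq0 g0 subrr mulr0 addr0 mulr1 /P1 mul0r addr0 phi0.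
  have BT := Bt _ Ut; have te0 : t *: e != 0 by rewrite scaler_eq0 (negbTE t0).
  have [L [_ LF _]] := Finv _ BT.
  have P10 : P1 t != 0.
    apply/eqP => P0; have := LF e; rewrite dFe // P0 scale0r linear0 => /eqP.
    by rewrite eq_sym (negbTE e0).
  have hE : h (t *: e) = (t * phi t / P1 t) *: e.
    rewrite -[LHS]LF hF // FP //.
    have -> : (t * phi t) *: e = 'd F (t *: e) ((t * phi t / P1 t) *: e).
      have lin c : 'd F (t *: e) (c *: e) = c *: 'd F (t *: e) e by rewrite linearZ.
      by rewrite lin dFe // scalerA divfK.
    by rewrite LF.
  have [T [Tn Tx]] := norming_functional (t *: e).
  have TS : support_functionals (t *: e) T.
    split=> //; first by move=> y; rewrite !nmE RtoC_le.
    move=> c c0 Hc; have := Hc (t *: e); rewrite Tx normr_id -[leLHS]mul1r.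
    by rewrite ler_pM2r // normr_gt0.
  have [z Uz zE] := hM _ BT te0 T TS; exists z; first exact/unit_diskE.
  have TZ c : T (c *: e) = c * T e by rewrite linearZ.
  have Te : T e = `|t *: e| / t by rewrite -Tx TZ mulrC mulKf.
  have nn : `|t *: e| != 0 by rewrite normr_eq0.
  have qE : `|t *: e| / T (h (t *: e)) = P1 t / phi t.
    rewrite hE TZ Te.
    (* If [phi t = 0], both quotients are [0] by the convention on inverses; the case is excluded
       just below by [g_beta_neq0]. *)
    have [->|p0] := eqVneq (phi t) 0; first by rewrite mulr0 !mul0r invr0 !mulr0.
    by field; rewrite t0 p0 P10 nn.
  move: zE; rewrite qE => zE.
  have gz := g_beta_neq0 ((unit_diskE z).1 Uz).
  have p0 : phi t != 0 by apply: contraNneq gz => p0; rewrite zE p0 invr0 mulr0.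
  by split=> //; rewrite -g_betaE zE mulrCA divff ?mulr1.
have [_ _ [finv [fK dfinv]]] := hg.
(* Solving for [g (w t)] and applying the inverse of [g] exhibits [w] as a composition of
   holomorphic functions, which a pointwise choice of [z] would not. *)
pose G t := 1 + kb^-1 * (P1 t / phi t - 1).
pose w t := finv (G t).
have Hw t : udisk t -> [/\ udisk (w t), g (w t) = G t, unit_disk (w t) & phi t != 0].
  move=> Ut; have [z Uz [p0 PE]] := Hq _ Ut.
  have GE : G t = g z.
    by rewrite /G PE (mulrC (phi t)) mulfK //; field; exact: kb_neq0.
  have wz : w t = z by rewrite /w GE fK //; exact/unit_diskE.
  by rewrite wz GE; split=> //; exact/unit_diskE.
have hw t : udisk t -> exists l, cder w t l.
  move=> Ut; have [_ gw Uw p0] := Hw _ Ut.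
  have hG : exists l, cder G t l.
    have D1 := cderD (dp _ Ut) (cderM (cder_id t) (dp1 _ Ut)).
    eexists; apply: cderD; first exact: cder_cst.
    apply: cderZ; apply: cderB; last exact: cder_cst.
    apply: cderM; first exact: D1.
    by apply: cderV => //; exact: dp.
  have [l Hl] := hG; have Hf := differentiable_cder (dfinv (G t) (ex_intro2 _ _ (w t) Uw gw)).
  by eexists; exact: cder_comp Hl Hf.
have wU t : udisk t -> udisk (w t) by case/Hw.
have w0 : w 0 = 0.
  rewrite /w /G /P1 phi0 mul0r addr0 divr1 subrr mulr0 addr0 -g0 fK //.
  exact/unit_diskE/udisk0.
have [w1 [w2 [dw dw1]]] := holomorphic_jet hw.
have [g1 [g2 [dg dg' g1E g2E]]] := g_tower.
have g10 : g1 0 != 0 by rewrite g1E dg1_neq0.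
have E z : udisk z -> phi z + z * 'D_1 phi z = phi z * (1 + kb * (g (w z) - 1)).
  move=> Uz; have [_ -> _ p0] := Hw _ Uz; rewrite -/(P1 z) /G.
  by field; rewrite p0 kb_neq0.
have [Q1 [Q2 [Q3 [h1 h2 h3 V]]]] := FS_coefficient lam dp dp1 dp2 dw dw1 dg dg'
  wU w0 g0 phi0 g10 E.
rewrite {1}xE (FS_on_line n lam FP h1 h2 h3) V.
have S := schwarz_order2 dw w0 wU dw1.
move: (w1 0) (w2 / 2) S => a c S; rewrite g1E g2E -/(mub lam).
rewrite [leLHS]nmE nmZ ne mulr1 (nmM (n ^+ 3)) nmX nm_RtoC (ger0_norm (nm_ge0 _)).
rewrite psi_betaE !nmE -!RtoCX -[2 in leRHS](RtoC_nat 2) -RtoCV -!RtoCM RtoC_le.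
set m := nm (mub lam).
(* By [S] the modulus is at most [(1 - |a|^2) + m |a|^2], a convex combination of [1] and [m]; [i1]
   and [i2] provide the products that linear arithmetic cannot form. *)
have B : nm (c + mub lam * a ^+ 2) <= Num.max 1 m.
  rewrite (le_trans (nmD _ _)) // nmM nmX.
  have m1 : 1 <= Num.max 1 m by rewrite le_max lexx.
  have m2 : m <= Num.max 1 m by rewrite le_max lexx orbT.
  have A0 : 0 <= nm a ^+ 2 by rewrite exprn_ge0.
  have A1 : 0 <= 1 - nm a ^+ 2 by exact: le_trans S.
  have i1 : 0 <= (Num.max 1 m - m) * nm a ^+ 2 by rewrite mulr_ge0 // subr_ge0.
  have i2 : 0 <= (Num.max 1 m - 1) * (1 - nm a ^+ 2) by rewrite mulr_ge0 // subr_ge0.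
  rewrite -/m; lra.
have c0 := ltW cos_pos.
set Y := c + _ in B *.
have -> : nm (kb * dg1 g / 2 * Y) = 2^-1 * (cos b * (nm Y * nm (dg1 g))).
  by rewrite (nmM (kb * dg1 g / 2)) (nmM (kb * dg1 g)) (nmM kb) nm_kb nm_half; ring.
have -> : nm x ^+ 3 / 2 * (cos b * Num.max 1 m) * nm (dg1 g) =
  nm x ^+ 3 * (2^-1 * (cos b * (Num.max 1 m * nm (dg1 g)))) by ring.
by do 3![apply: ler_wpM2l; rewrite ?exprn_ge0 ?invr_ge0 //]; rewrite ler_wpM2r.
Qed.

End Estimate.

(** * Frechet derivatives of functions of a functional and of their multiples of the identity *)

Section FrechetCriterion.
Context {R : realType} {V W : normedModType (Cpx R)}.
Local Notation C := (Cpx R).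

Lemma bounded_linear_continuous (L : {linear V -> W}) (M : R) :
  (forall v, nm (L v) <= M * nm v) -> continuous L.
Proof.
move=> LM x; apply/cvgC => e e0; apply/nearC.
have K0 : 0 < `|M| + 1 by rewrite ltr_wpDl.
exists (e / (`|M| + 1)); first by rewrite divr_gt0.
move=> h; rewrite ltr_pdivlMr // => hh.
rewrite linearD addrAC subrr add0r (le_trans (LM h)) // (le_trans _ (ltW hh)) //.
rewrite mulrC ler_wpM2l // (le_trans (ler_norm M)) //; lra.
Qed.

Lemma frechetP (F : V -> W) (x : V) (L : {linear V -> W}) :
  continuous L ->
  (forall e : R, 0 < e -> exists2 d : R, 0 < d &
    forall h, nm h < d -> nm (F (x + h) - F x - L h) <= e * nm h) ->
  differentiable F x /\ forall v, 'd F x v = L v.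
Proof.
move=> cL H.
have E : F \o shift x = cst (F x) + L +o_ 0 id.
  apply/eqaddoP => e e0.
  have er : e \is Num.real by rewrite gtr0_real.
  have ee : e = RtoC (complex.Re e) by rewrite /RtoC RRe_real.
  have re0 : 0 < complex.Re e by rewrite -RtoC_lt -ee.
  have [d d0 Hd] := H _ re0; apply/(nearC (0 : V)); exists d => // h hd; rewrite add0r.
  rewrite ee nmE [in leRHS]nmE -RtoCM RtoC_le /=.
  have := Hd h hd; rewrite -addrA -opprD (addrC x h).
  exact.
have dE := diff_unique cL E.
split; last by move=> v; rewrite dE.
by apply/diff_locallyP; rewrite dE.
Qed.

End FrechetCriterion.

Section FunctionalMultiple.
Context {R : realType} {X : normedModType (Cpx R)}.
Local Notation C := (Cpx R).
Variables (T : {linear X -> C}) (c : C -> C) (c1 : C) (x : X).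
Hypothesis Tn : forall y, nm (T y) <= nm y.
Hypothesis dc : cder c (T x) c1.

Lemma functional_comp_differentiable : differentiable (fun y => c (T y)) x.
Proof.
pose l v : C := c1 * T v.
have llin : linear l by move=> a u v; rewrite /l linearP mulrDr [_ *: l u]/(_ * _) mulrCA.
pose L : {linear X -> C} := HB.pack l (GRing.isLinear.Build _ _ _ _ l llin).
have cL : continuous L.
  by apply: (@bounded_linear_continuous _ _ _ L (nm c1)) => v; rewrite nmM ler_wpM2l.
have [|//] := @frechetP _ _ _ (fun y => c (T y)) x L cL.
move=> e e0; have [d d0 Hd] := dc e0; exists d => // h hd.
rewrite -[L h]/(c1 * T h) linearD (le_trans (Hd _ (le_lt_trans (Tn h) hd))) //.
by rewrite ler_wpM2l // (ltW e0).
Qed.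

Lemma functional_multiple_differentiable :
  differentiable (fun y => c (T y) *: y) x /\
  forall v, 'd (fun y => c (T y) *: y) x v = (c1 * T v) *: x + c (T x) *: v.
Proof.
pose l v : X := (c1 * T v) *: x + c (T x) *: v.
have llin : linear l.
  move=> a u v; rewrite /l linearP mulrDr scalerDl !scalerDr !scalerA.
  by rewrite [_ *: T u]/(_ * _) mulrCA (mulrC (c (T x))) addrACA.
pose L : {linear X -> X} := HB.pack l (GRing.isLinear.Build _ _ _ _ l llin).
have cL : continuous L.
  apply: (@bounded_linear_continuous _ _ _ L (nm c1 * nm x + nm (c (T x)))) => v.
  rewrite (le_trans (nmD _ _)) // (nmZ (c1 * _)) (nmZ (c _)) (nmM c1) mulrDl lerD2r mulrAC.
  by rewrite ler_wpM2l ?mulr_ge0.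
apply: (@frechetP _ _ _ _ x L cL) => e e0.
have e10 : 0 < e / 2 / (nm x + 1) by rewrite !divr_gt0 // ltr_wpDl.
have e20 : 0 < e / 2 by rewrite divr_gt0.
have [d1 d10 H1] := dc e10; have [d2 d20 H2] := cder_cont dc e20.
exists (Num.min d1 d2); first by rewrite lt_min d10.
move=> h; rewrite lt_min => /andP[h1 h2].
have {}H1 := H1 _ (le_lt_trans (Tn h) h1); have {}H2 := H2 _ (le_lt_trans (Tn h) h2).
(* The remainder is the first-order remainder of [c] along [x] plus the increment of [c], small by
   continuity, times [h]. *)
have -> : c (T (x + h)) *: (x + h) - c (T x) *: x - L h =
  (c (T x + T h) - c (T x) - c1 * T h) *: x + (c (T x + T h) - c (T x)) *: h.
  rewrite -[L h]/(l h) /l; have -> : T (x + h) = T x + T h by rewrite linearD.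
  move: (c (T x + T h)) (c (T x)) (c1 * T h) => p r q.
  by rewrite scalerDr !scalerBl opprD (addrAC (p *: x)) addrACA.
rewrite (le_trans (nmD _ _)) // !nmZ [e]splitr mulrDl lerD //; last by rewrite ler_wpM2r.
have x1 : 0 < nm x + 1 by rewrite ltr_wpDl.
apply: (@le_trans _ _ (e / 2 / (nm x + 1) * nm h * (nm x + 1))).
  rewrite ler_pM // ?lerDl //; apply: (le_trans H1).
  by rewrite ler_wpM2l // (ltW e10).
by rewrite mulrAC divfK // gt_eqF.
Qed.

End FunctionalMultiple.

(** * Extremal mappings *)

Section Sharpness.
Context {R : realType}.
Local Notation C := (Cpx R).

Lemma udisk_exhausted : cvx_exhausted (@udisk R).
Proof.
move=> x y z hx hy hz; have := @disk_exhausted R 0 1 x y z; rewrite !subr0.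
move=> /(_ hx hy hz)[K [h1 h2 h3 h4]]; exists K; split=> // u /h3.
by rewrite subr0.
Qed.

(** Removable singularity made explicit: the value at [0] is [Y'(0)], and the second-order expansion
    of [Y] gives the derivative [Y''(0) / 2] there. *)
Lemma divided_by_id (Y : C -> C) :
  (forall z, udisk z -> exists l, cder Y z l) -> Y 0 = 0 ->
  exists psi, (forall z, udisk z -> exists l, cder psi z l) /\ forall z, z * psi z = Y z.
Proof.
move=> hY Y0; have [Y1 [Y2 [dY dY1]]] := holomorphic_jet hY; have U0 := @udisk0 R.
pose psi (z : C) : C := if z == 0 then Y1 0 else Y z / z.
exists psi; split; last first.
  move=> z; rewrite /psi; case: eqVneq => [->|z0]; first by rewrite mul0r Y0.
  by rewrite mulrC divfK.
move=> z Uz; have [->|z0] := eqVneq z 0.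
  exists (Y2 / 2) => e e0; have [d d0 Hd] := taylor2 udisk_opn dY U0 dY1 e0.
  exists d => // h hd; rewrite add0r /psi eqxx; case: eqVneq => [->|h0].
    by rewrite subrr mulr0 subrr nm0 mulr0.
  have := Hd h hd; rewrite add0r Y0 subr0 => {}Hd.
  have -> : Y h / h - Y1 0 - Y2 / 2 * h = (Y h - Y1 0 * h - Y2 / 2 * h ^+ 2) / h by field.
  have ee : e * nm h ^+ 2 = e * nm h * nm h by rewrite expr2 mulrA.
  by rewrite nmM nmV ler_pdivrMr ?nm_gt0 // -ee.
have nz : 0 < nm z by rewrite nm_gt0.
eexists; apply: (cder_near nz _ (cderM (dY _ Uz) (cder_inv z0))) => h hz.
rewrite /psi ifN //; apply: contraTneq hz => zh0.
have -> : h = - z by apply/eqP; rewrite -addr_eq0 addrC zh0.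
by rewrite nmN ltxx.
Qed.

Variables (b : R) (g : C -> C).
Hypothesis hb : `|b| < pi / 2.
Hypothesis hg : biholomorphic_on unit_disk g.
Hypothesis g0 : g 0 = 1.
Hypothesis Reg : forall z, unit_disk z -> 0 < complex.Re (g z).

(** Any admissible [w] can be prescribed: the exponential of a primitive of [k (g o w - 1) / z]
    solves the equation for [phi] and has no zeros. Since the resulting [h] is [x / q (T x)], every
    support functional at [x] gives the same quotient [q (T x)], so the single functional [T]
    settles membership in the class. *)
Lemma extremal_map (X : normedModType C) (w w1 : C -> C) (w2 lam : C) (x0 : X) :
  (forall z, udisk z -> cder w z (w1 z)) -> cder w1 0 w2 ->
  (forall z, udisk z -> udisk (w z)) -> w 0 = 0 -> x0 != 0 ->
  exists F : X -> X, admissible g b F /\ exists x : X, [/\ unit_ball x, x != 0 &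
    `|FS_functional F lam x| = `|x| ^+ 3 *
      RtoC (nm (kb b * dg1 g / 2 * (w2 / 2 + mub b g lam * w1 0 ^+ 2)))].
Proof.
move=> dw dw1 wU w0 x00.
have gc := g_cder hg.
pose Y t := kb b * (g (w t) - 1).
have hY z : udisk z -> exists l, cder Y z l.
  move=> Uz; have [l Hl] := gc _ (wU _ Uz).
  by eexists; apply: cderZ; apply: cderB (cder_cst _ _); exact: cder_comp (dw _ Uz) Hl.
have Y0 : Y 0 = 0 by rewrite /Y w0 g0 subrr mulr0.
have [psi [hpsi psiE]] := divided_by_id hY Y0.
have [Q HQ] := primitive udisk_opn udisk_exhausted hpsi.
pose phi t := cexp (Q t - Q 0).
have dphi z : udisk z -> cder phi z (phi z * psi z).
  move=> Uz; have := cder_comp (cderB (HQ _ Uz) (cder_cst (Q 0) z)) (cder_cexp _).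
  by rewrite subr0.
have phi0 : phi 0 = 1 by rewrite /phi subrr cexp0.
have phin z : phi z != 0 by exact: cexp_neq0.
have [p1 [p2 [dp dp1 dp2]]] : exists p1 p2, [/\ forall z, udisk z -> cder phi z (p1 z),
    forall z, udisk z -> cder p1 z (p2 z) & forall z, udisk z -> exists l, cder p2 z l].
  have [|h1 h2 h3] := @holomorphic_tower R phi; first by move=> z /dphi h; eexists; exact: h.
  by exists ('D_1 phi), ('D_1 ('D_1 phi)).
have p1E z : udisk z -> p1 z = phi z * psi z.
  by move=> Uz; exact: cder_uniq (dp _ Uz) (dphi _ Uz).
have E z : udisk z -> phi z + z * p1 z = phi z * (1 + kb b * (g (w z) - 1)).
  by move=> Uz; rewrite p1E // mulrDr mulr1 mulrCA psiE.
have [T [Tn Tx]] := norming_functional x0.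
have nx0 : `|x0| != 0 by rewrite normr_eq0.
pose e := `|x0|^-1 *: x0.
have TZ (c : C) y : T (c *: y) = c * T y by rewrite linearZ.
have TD y z : T (y + z) = T y + T z by rewrite linearD.
have TB y z : T (y - z) = T y - T z by rewrite linearB.
have Te : T e = 1 by rewrite TZ Tx mulVf.
have ne : nm e = 1.
  by apply: RtoC_inj; rewrite -nmE normrZ normfV normr_id mulVf.
clearbody e.
have UT x : unit_ball x -> udisk (T x).
  rewrite /unit_ball /= nmE -RtoC1 RtoC_lt => h; exact: le_lt_trans (Tn x) h.
pose F x := phi (T x) *: x.
pose q z := 1 + kb b * (g (w z) - 1).
have qg z : q z = g_beta g b (w z) by rewrite g_betaE.
have qn z : udisk z -> q z != 0 by move=> Uz; rewrite qg; exact: (g_beta_neq0 hb Reg (wU _ Uz)).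
have dF x : unit_ball x -> differentiable F x /\
    forall v, 'd F x v = (p1 (T x) * T v) *: x + phi (T x) *: v.
  by move=> Bx; exact: functional_multiple_differentiable Tn (dp _ (UT _ Bx)).
have FP t : udisk t -> F (t *: e) = (t * phi t) *: e.
  by move=> Ut; rewrite /F TZ Te mulr1 scalerA mulrC.
exists F; split; last first.
  (* Both sides scale like the cube of the norm along the line, so any nonzero point of it inside
     the ball would do. *)
  pose n : C := RtoC 2^-1.
  have nn : nm n = 2^-1 by rewrite nm_RtoC ger0_norm // invr_ge0.
  have nne : nm (n *: e) = 2^-1 by rewrite nmZ ne nn mulr1.
  exists (n *: e); split.
  - by rewrite /unit_ball /= nmE nne -RtoC1 RtoC_lt invf_lt1 // ltr1n.
  - by rewrite -nm_gt0 nne invr_gt0.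
  have [g1 [g2 [dg dg' g1E g2E]]] := g_tower hg.
  have g10 : g1 0 != 0 by rewrite g1E; exact: dg1_neq0.
  have [Q1 [Q2 [Q3 [h1 h2 h3 Vl]]]] := FS_coefficient lam dp dp1 dp2 dw dw1 dg dg'
    wU w0 g0 phi0 g10 E.
  rewrite (FS_on_line n lam FP h1 h2 h3) Vl g1E g2E -/(mub b g lam).
  rewrite [LHS]nmE nmZ ne mulr1 (nmM (n ^+ 3)) nmX nn RtoCM.
  by rewrite [in RHS]nmE nne RtoCX.
split; first by move=> x /dF[].
split.
  exists (fun x => phi (T x)); split=> // x Bx.
  exact: functional_comp_differentiable Tn (dp _ (UT _ Bx)).
have B0 : unit_ball (0 : X) by rewrite /unit_ball /= normr0.
split; first by rewrite /F scaler0.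
split.
  by move=> v; have [_ ->] := dF _ B0; rewrite scaler0 add0r linear0 phi0 scale1r.
have DE x : unit_ball x -> phi (T x) + p1 (T x) * T x = phi (T x) * q (T x).
  by move=> Bx; rewrite (mulrC (p1 _)) E //; exact: UT.
split.
  move=> x Bx; have Ux := UT _ Bx; have [_ dFx] := dF _ Bx.
  have qx := qn _ Ux; have px := phin (T x); have De := DE _ Bx.
  move: (phi (T x)) (q (T x)) (p1 (T x)) qx px De dFx => p qq r qx px De dFx.
  (* The derivative is [p] times the identity plus the rank-one map sending [v] to [(r * T v) *: x];
     this is its Sherman-Morrison inverse, with denominator [p + r * T x = p * qq]. *)
  pose l v : X := p^-1 *: (v - (r * T v / (p * qq)) *: x).
  have llin : linear l.
    move=> a u v; rewrite /l; have -> : T (a *: u + v) = a * T u + T v by rewrite linearP.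
    have sw y : a *: (p^-1 *: y) = p^-1 *: (a *: y) by rewrite !scalerA mulrC.
    rewrite sw -scalerDr; congr (_ *: _).
    by rewrite scalerBr scalerA addrACA -opprD -scalerDl; congr (_ - _ *: _); ring.
  pose L : {linear X -> X} := HB.pack l (GRing.isLinear.Build _ _ _ _ l llin).
  exists L; split.
  - apply: (@bounded_linear_continuous _ _ _ L
      (nm p^-1 * (1 + nm r * nm (p * qq)^-1 * nm x))) => v.
    rewrite -[L v]/(l v) /l.
    apply: (@le_trans _ _ (nm p^-1 * (nm v + nm (r * T v / (p * qq)) * nm x))).
      by rewrite (nmZ p^-1) ler_wpM2l // (le_trans (nmB _ _)) // (nmZ (_ / _)).
    rewrite -[leRHS]mulrA; apply: ler_wpM2l => //; rewrite mulrDl mul1r lerD2l.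
    rewrite (nmM (r * T v)) (nmM r); set K := nm (p * qq)^-1.
    have K0 : 0 <= K by exact: nm_ge0.
    have -> : nm r * nm (T v) * K * nm x = nm r * K * nm x * nm (T v) by ring.
    by apply: ler_wpM2l; rewrite ?mulr_ge0 //.
  - move=> v; rewrite -[L _]/(l _) /l dFx TD !TZ.
    rewrite addrAC -scalerBl.
    have -> : r * T v - r * (r * T v * T x + p * T v) / (p * qq) = 0.
      by rewrite -De; field; rewrite De mulf_neq0.
    by rewrite scale0r add0r scalerA mulVf // scale1r.
  - move=> v; rewrite -[L v]/(l v) dFx /l TZ TB TZ !scalerA mulfV // scale1r.
    rewrite addrC -addrA -scaleNr -scalerDl.
    have -> : - (r * T v / (p * qq)) + r * (p^-1 * (T v - r * T v / (p * qq) * T x)) = 0.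
      by rewrite -De; field; rewrite De mulf_neq0.
    by rewrite scale0r addr0.
exists (fun x => (q (T x))^-1 *: x); split.
  move=> x Bx; have Ux := UT _ Bx; have [_ ->] := dF _ Bx.
  rewrite TZ scalerA -scalerDl /F; congr (_ *: _).
  have -> : p1 (T x) * ((q (T x))^-1 * T x) + phi (T x) * (q (T x))^-1 =
    (phi (T x) + p1 (T x) * T x) / q (T x) by ring.
  by rewrite DE // mulfK // qn.
split.
  move=> x Bx; have Ux := UT _ Bx; have [l Hl] := hY _ Ux.
  have dq : cder (fun z => (q z)^-1) (T x) (- (0 + l) / q (T x) ^+ 2).
    by apply: cderV; [exact: qn|apply: cderD => //; exact: cder_cst].
  by have [] := functional_multiple_differentiable Tn dq.
move=> x Bx xn0 T' [_ _ T'x]; have Ux := UT _ Bx.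
exists (w (T x)); first by apply/unit_diskE; exact: wU.
rewrite linearZ /= T'x -qg [_ *: _]/(_ * _) invfM invrK.
by rewrite mulrCA divff ?mulr1 // normr_eq0.
Qed.

Theorem sharpness (X : normedModType C) (lam : C) (x0 : X) : x0 != 0 ->
  exists F : X -> X, admissible g b F /\ exists x : X, [/\ unit_ball x, x != 0 &
    `|FS_functional F lam x| = `|x| ^+ 3 / 2 * psi_beta g b lam * `|dg1 g|].
Proof.
move=> x00; set m := nm (mub b g lam).
have [w [w1 [w2 [[dw dw1 wU w0] V]]]] : exists w w1 w2,
    [/\ forall z, udisk z -> cder w z (w1 z), cder w1 0 w2,
      forall z : C, udisk z -> udisk (w z) & w 0 = 0] /\
    nm (w2 / 2 + mub b g lam * w1 0 ^+ 2) = Num.max 1 m.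
  (* The larger term of the maximum decides: [t^2] has [w1 0 = 0] and [w2 / 2 = 1], which gives [1];
     the identity has [w1 0 = 1] and [w2 = 0], which gives [m]. *)
  have [m1|m1] := lerP m 1.
    exists (fun z => z * z), (fun z => 1 * z + z * 1), (1 * 1 + 1 * 1); split; first split.
    - by move=> z _; exact: cderM (cder_id z) (cder_id z).
    - have := cderD (cderZ 1 (cder_id 0)) (cderZ 1 (cder_id (0 : C))).
      by apply: cder_near ltr01 _ => h _; rewrite !mul1r mulr1.
    - move=> z; rewrite /udisk nmM => z1.
      by rewrite (le_lt_trans _ z1) // ler_piMl // ltW.
    - exact: mulr0.
    - rewrite mul0r mulr0 addr0 expr0n /= mulr0 addr0.
      have -> : (1 * 1 + 1 * 1) / 2 = 1 :> C by field.
      by rewrite nm1.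
  exists id, (fun=> 1), 0; split; first split=> //.
  - by move=> z _; exact: cder_id.
  - exact: cder_cst.
  - by rewrite mul0r add0r expr1n mulr1.
have [F [aF [x [Bx xn0 FE]]]] := extremal_map lam dw dw1 wU w0 x00.
exists F; split=> //; exists x; split=> //; rewrite FE psi_betaE //.
set Y := w2 / 2 + _ in V *.
rewrite (nmM (kb b * dg1 g / 2)) (nmM (kb b * dg1 g)) (nmM (kb b)) nm_kb // nm_half V.
rewrite [`|dg1 g|]nmE !RtoCM RtoCV RtoC_nat -/m; ring.
Qed.

End Sharpness.

Unset Implicit Arguments.

Theorem theorem2 (R : realType) (X : completeNormedModType (Cpx R))
  (b : R) (g : Cpx R -> Cpx R) :
  `|b| < pi / 2 ->
  biholomorphic_on unit_disk g ->
  g 0 = 1 ->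
  (forall z, unit_disk z -> 0 < complex.Re (g z)) ->
  (* the estimate *)
  (forall F : X -> X, admissible g b F ->
     forall (lam : Cpx R) (x : X), unit_ball x -> x != 0 ->
       `|FS_functional F lam x| <= `|x| ^+ 3 / 2 * psi_beta g b lam * `|dg1 g|)
  /\
  (* sharpness: for every lambda (X nontrivial) equality is attained *)
  (forall lam : Cpx R, (exists x : X, x != 0) ->
     exists F : X -> X, admissible g b F /\
       exists x : X, [/\ unit_ball x, x != 0 &
         `|FS_functional F lam x| = `|x| ^+ 3 / 2 * psi_beta g b lam * `|dg1 g| ]).
Proof.
move=> hb hg g0 Reg; split; first by move=> F adF lam x; exact: estimate.
by move=> lam [x0 x00]; exact: (sharpness hb hg g0 Reg lam x00).
Qed.
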